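(* Let $L$ be a Latin array of order $n$. If $L$ has at least $(2-\sqrt2)n^2$ distinct symbols, then $L$ has a transversal.
   Context: An array of order $n$ is an $n\times n$ array with a symbol in each cell; an entry is a triple $(i,j,A_{ij})$. An array is Latin if no symbol appears more than once in any row or column. A transversal of an $n\times n$ array is a set of $n$ entries, no two agreeing in row, column, or symbol. *)

(* Defs.v *)
From HB Require Import structures.
From mathcomp Require Import all_boot all_order all_algebra.
Set Implicit Arguments. Unset Strict Implicit. Unset Printing Implicit Defensive.
Import Order.TTheory GRing.Theory Num.Theory.

Definition is_latin (T : eqType) (n : nat) (A : 'I_n -> 'I_n -> T) : Prop :=
  (forall i j1 j2, A i j1 = A i j2 -> j1 = j2) /\
  (forall i1 i2 j, A i1 j = A i2 j -> i1 = i2).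

Definition num_symbols (T : eqType) (n : nat) (A : 'I_n -> 'I_n -> T) : nat :=
  size (undup [seq A c.1 c.2 | c <- enum [set: 'I_n * 'I_n]]).

(* A transversal: a set of n entries (cells), no two agreeing in row, column
   or symbol. Entries are identified with their cells (the symbol is determined). *)
Definition is_transversal (T : eqType) (n : nat) (A : 'I_n -> 'I_n -> T)
    (S : {set 'I_n * 'I_n}) : Prop :=
  #|S| = n /\
  (forall c d, c \in S -> d \in S -> c <> d ->
     [/\ c.1 <> d.1, c.2 <> d.2 & A c.1 c.2 <> A d.1 d.2]).

Definition has_transversal (T : eqType) (n : nat) (A : 'I_n -> 'I_n -> T) : Prop :=
  exists S, is_transversal A S.

(* Main.v *)
Require Import Defs.
From HB Require Import structures.
From mathcomp Require Import all_boot all_order all_algebra.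
From mathcomp Require Import fingroup perm zify ring lra.
Import Order.TTheory GRing.Theory Num.Theory.
Set Implicit Arguments. Unset Strict Implicit. Unset Printing Implicit Defensive.

(** Write c = 2 - sqrt 2 and take a counterexample of least order n and, for that
    order, with the most symbols.  A cell is single if its symbol occurs only once.
    - Giving a repeated cell a new symbol creates a transversal, so deleting the row
      and the column of a cell that is not single leaves an array with a transversal T.
    - Deleting the row and the column of a single cell leaves no transversal, so by
      minimality more than c(2n - 1) symbols are lost.
    Suppose a single cell lies in a row and in a column neither of which consists of
    single cells only.  Then some T misses that row (or that column), and at least
    half of the lost symbols occur in it without occurring in T.  Swapping them in
    frees many vertices w of T (cells of T), and each pair of a free w and another
    vertex v spans two cells at most one of which can be used to represent a symbol
    outside T.  Counting representatives bounds the number of symbols below c n^2.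
    Otherwise all single cells lie in full rows or full columns.  Full rows and full
    columns together contradict a chain argument of Woolbright.  If there are only
    full columns, take a largest partial transversal in the other columns, with as
    few of its symbols as possible in the column it misses: its symbols then fill so
    many cells that it is short compared with the number of free rows, whereas two
    successive swaps show that it is long. *)

(** * Counting representatives of symbols outside a partial transversal *)

Section PairCount.
Variables (I Y : finType) (M : I -> I -> Y) (o : I).
Hypothesis rowM : forall u, injective (M u).
Hypothesis colM : forall v, injective (M^~ v).
Hypothesis diagM : {in predC1 o &, injective (fun v => M v v)}.
Hypothesis norainbow : forall s : {perm I}, ~ injective (fun u => M u (s u)).

(** Columns are labelled so that a partial transversal becomes the diagonal without [(o, o)]. [K] is
    its symbol set, and a symbol outside [K] is called fresh below. *)
Let K := [set M v v | v in predC1 o].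

(** Diagonal cells outside [D] stay; those in [D] give way to the cells [(u, s u)]. A new symbol may
    be fresh or be that of a diagonal cell given up, so the result would be a transversal. The moves
    below are instances with at most four vertices in [D]. *)
Lemma rainbow_switch (s : {perm I}) (D : {set I}) :
  o \in D -> (forall u, u \notin D -> s u = u) ->
  {in D, forall u, M u (s u) \notin K \/
     exists w, [/\ w \in D, w != o & M u (s u) = M w w]} ->
  {in D &, injective (fun u => M u (s u))} -> False.
Proof.
move=> oD fixD valD injD; apply: (norainbow (s := s)).
have nD u v : u \in D -> v \notin D -> M u (s u) = M v v -> False.
  move=> uD vD e; have vo : v != o by apply: contraNneq vD => ->.
  case: (valD u uD) => [|[w [wD wo e']]].
    by rewrite e => /negP; apply; apply/imsetP; exists v.
  have vw : v = w by apply: diagM => //=; rewrite -e.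
  by move: vD; rewrite vw wD.
move=> u v /= e.
case uD: (u \in D); case vD: (v \in D).
- exact: injD.
- by case: (nD u v) => //; [rewrite vD | rewrite e fixD // vD].
- by case: (nD v u) => //; [rewrite uD | rewrite -e fixD // uD].
- move: e; rewrite !fixD ?uD ?vD //; apply: diagM; rewrite !inE.
    by apply: contraFneq uD => ->.
  by apply: contraFneq vD => ->.
Qed.

Lemma two_cycle v : v != o -> M o v \notin K -> M v o \notin K -> M o v = M v o.
Proof.
move=> vo k1 k2; apply/eqP/negPn/negP => ne.
apply: (@rainbow_switch (tperm o v) [set o; v]).
- by rewrite !inE eqxx.
- by move=> u; rewrite !inE negb_or => /andP[a b]; rewrite tpermD // 1?eq_sym.
- by move=> u; rewrite !inE => /orP[]/eqP->; left; rewrite ?tpermL ?tpermR.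
- move=> u w; rewrite !inE => /orP[]/eqP-> /orP[]/eqP-> //=;
  by rewrite tpermL tpermR => e; move: ne; rewrite e eqxx.
Qed.

Lemma base_in : M o o \in K.
Proof.
apply/negPn/negP => ne.
apply: (@rainbow_switch 1%g [set o]).
- by rewrite inE.
- by move=> u _; rewrite perm1.
- by move=> u; rewrite !inE => /eqP->; left; rewrite perm1.
- by move=> u w; rewrite !inE => /eqP-> /eqP->.
Qed.

Section LabelMoves.
Variables u w : I.
Hypotheses (uo : u != o) (wo : w != o) (uw : u != w).
Hypothesis fresh_ou : M o u \notin K.
Hypothesis lab_uo : M u o = M w w.

Lemma label_in_K : M u o \in K.
Proof. by rewrite lab_uo; apply/imsetP; exists w. Qed.

(** Taking [(o, u)] and [(u, o)] costs the diagonal cells at [u] and at [w], since [M u o] repeats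
    the symbol of the latter. Now [w] is the free vertex, and the two-cycle argument is repeated
    there. *)
Lemma pair_swap v : v != o -> v != u -> v != w ->
  M w v \notin K -> M v w \notin K -> M w v != M o u -> M v w != M o u ->
  M w v = M v w.
Proof.
move=> vo vu vw k1 k2 n1 n2; apply/eqP/negPn/negP => ne.
pose s := (tperm o u * tperm w v)%g.
have so : s o = u by rewrite permM tpermL tpermD // 1?eq_sym.
have su : s u = o by rewrite permM tpermR tpermD.
have sw : s w = v.
  by rewrite permM (tpermD (x := o)) ?tpermL // 1?eq_sym.
have sv : s v = w.
  by rewrite permM (tpermD (x := o)) ?tpermR // 1?eq_sym.
have kuo := label_in_K.
apply: (@rainbow_switch s [set o; u; w; v]).
- by rewrite !inE eqxx.
- move=> z; rewrite !inE !negb_or => /andP[/andP[/andP[a b] c] d].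
  by rewrite permM !tpermD // 1?eq_sym.
- move=> z; rewrite !inE -!orbA => /or4P[]/eqP->; rewrite ?so ?su ?sw ?sv; try by left.
  by right; exists w; rewrite !inE eqxx ?orbT.
- have nn a b : a \notin K -> b \in K -> a <> b by move=> h1 h2 e; rewrite e h2 in h1.
  have n3 : M w v <> M v w by apply/eqP.
  move/eqP: n1 => n1; move/eqP: n2 => n2.
  have m1 := nn _ _ fresh_ou kuo; have m2 := nn _ _ k1 kuo; have m3 := nn _ _ k2 kuo.
  move=> z z'; rewrite !inE -!orbA => /or4P[]/eqP-> /or4P[]/eqP->;
    rewrite ?so ?su ?sw ?sv //; by move=> e; exfalso; congruence.
Qed.

Let three := [set o; u; w].

(** The cells [(u, o)], [(o, w)], [(w, u)] replace the diagonal at [u] and [w]; the first carries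
    the symbol given up at [w], so the other two must coincide. *)
Lemma cycle_ow : M w u \notin K -> M o w \notin K -> M w u = M o w.
Proof.
move=> k1 k2; apply/eqP/negPn/negP => /eqP ne.
(* s^-1 is the cycle o -> w -> u -> o *)
pose s := (tperm o u * tperm o w)%g.
have so : s o = u by rewrite permM tpermL tpermD // 1?eq_sym.
pose s' := (s^-1)%g.
have e1 : s' u = o by rewrite -so permK.
have sw : s w = o by rewrite permM (tpermD (x := o) (y := u)) ?tpermR // 1?eq_sym.
have e2 : s' o = w by rewrite -sw permK.
have su : s u = w by rewrite permM tpermR tpermL.
have e3 : s' w = u by rewrite -su permK.
have kuo := label_in_K.
apply: (@rainbow_switch s' three).
- by rewrite !inE eqxx.
- move=> z; rewrite !inE !negb_or => /andP[/andP[a b] c].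
  apply: (@perm_inj _ s); rewrite permKV permM !tpermD // 1?eq_sym //.
- move=> z; rewrite !inE -!orbA => /or3P[]/eqP->; rewrite ?e1 ?e2 ?e3; try by left.
  by right; exists w; rewrite !inE eqxx ?orbT.
- have nn a b : a \notin K -> b \in K -> a <> b by move=> h1 h2 e; rewrite e h2 in h1.
  have m1 := nn _ _ k1 kuo; have m2 := nn _ _ k2 kuo.
  move=> z z'; rewrite !inE -!orbA => /or3P[]/eqP-> /or3P[]/eqP->;
    rewrite ?e1 ?e2 ?e3 //; by move=> e; exfalso; congruence.
Qed.

(** The opposite cycle uses [(o, u)], [(u, w)], [(w, o)]. All three are fresh, and only the last two
    can coincide. *)
Lemma cycle_wo : M u w \notin K -> M w o \notin K ->
  M u w != M o u -> M w o != M o u -> M u w = M w o.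
Proof.
move=> k1 k2 /eqP n1 /eqP n2; apply/eqP/negPn/negP => /eqP ne.
pose s := (tperm o u * tperm o w)%g.
have so : s o = u by rewrite permM tpermL tpermD // 1?eq_sym.
have sw : s w = o by rewrite permM (tpermD (x := o) (y := u)) ?tpermR // 1?eq_sym.
have su : s u = w by rewrite permM tpermR tpermL.
apply: (@rainbow_switch s three).
- by rewrite !inE eqxx.
- move=> z; rewrite !inE !negb_or => /andP[/andP[a b] c].
  rewrite permM !tpermD // 1?eq_sym //.
- by move=> z; rewrite !inE -!orbA => /or3P[]/eqP->; rewrite ?so ?sw ?su; left.
- move=> z z'; rewrite !inE -!orbA => /or3P[]/eqP-> /or3P[]/eqP->;
    rewrite ?so ?sw ?su //; by move=> e; exfalso; congruence.
Qed.
End LabelMoves.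


Variable X : {set I}.
Hypothesis XP : forall u, u \in X -> [/\ u != o, M o u \notin K & M u o != M o u].

(** The vertex freed by swapping in [u]: its diagonal symbol reappears at [(u, o)]. For [u] in [X]
    the default [o] is never taken. *)
Let lab u := odflt o [pick w | (w != o) && (M u o == M w w)].

Lemma labP u : u \in X -> [/\ lab u != o, M u o = M (lab u) (lab u) & u != lab u].
Proof.
move=> /XP[uo k ne].
have : M u o \in K.
  by apply: contraTT isT => h; move: ne; rewrite (two_cycle uo k h) eqxx.
case/imsetP => w wo e; rewrite /lab; case: pickP => [z /andP[zo /eqP ez]|/(_ w)] /=.
  split=> //; apply: contraNneq uo => uz.
  by move: ez; rewrite -uz => /rowM ->.
by rewrite e eqxx andbT; move: wo; rewrite !inE => ->.
Qed.

Lemma lab_inj : {in X &, injective lab}.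
Proof.
move=> u v /labP[_ e _] /labP[_ e' _] l.
by apply: (@colM o); rewrite /= e e' l.
Qed.

Let symM := [set M a.1 a.2 | a : I * I].

(* Every off-diagonal symbol gets one representing cell; the symbols M o u, u in X,
   are represented in row o, so that a representing cell never repeats one of them. *)
Let rep y : I * I :=
  if [pick u in X | M o u == y] is Some u then (o, u)
  else odflt (o, o) [pick a | M a.1 a.2 == y].
Let R := [set rep y | y in symM :\: K].

Lemma repE y : y \in symM -> M (rep y).1 (rep y).2 = y.
Proof.
case/imsetP => -[a b] _ ->; rewrite /rep; case: pickP => [u /andP[_ /eqP] //|_].
by case: pickP => [c /eqP //|/(_ (a, b))]; rewrite eqxx.
Qed.

Lemma R_fresh a : a \in R -> M a.1 a.2 \notin K.
Proof. by case/imsetP => y /setDP[yS yK] ->; rewrite repE. Qed.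

Lemma R_inj a b : a \in R -> b \in R -> M a.1 a.2 = M b.1 b.2 -> a = b.
Proof. by case/imsetP => y /setDP[yS _] -> /imsetP[z /setDP[zS _] ->]; rewrite !repE // => ->. Qed.

Lemma R_row u : u \in X -> (o, u) \in R.
Proof.
move=> uX; have [_ k _] := XP uX.
apply/imsetP; exists (M o u); last first.
  rewrite /rep; case: pickP => [v /andP[_ /eqP /rowM -> //]|/(_ u)].
  by rewrite uX eqxx.
by rewrite inE k; apply/imsetP; exists (o, u).
Qed.

Lemma R_diag v : (v, v) \notin R.
Proof.
apply/negP => /R_fresh /negP; apply => /=; case: (eqVneq v o) => [->|vo].
  exact: base_in.
by apply/imsetP; exists v.
Qed.

Lemma R_two v : v != o -> (o, v) \in R -> (v, o) \in R -> False.
Proof.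
move=> vo r1 r2; have e := two_cycle vo (R_fresh r1) (R_fresh r2).
by case: (R_inj r1 r2 e) => e1 _; move: vo; rewrite -e1 eqxx.
Qed.

Lemma R_ne a u : u \in X -> a.1 != o -> a \in R -> M a.1 a.2 != M o u.
Proof.
move=> uX ao r; apply/eqP => e.
by move: ao; rewrite (R_inj r (R_row uX) e) eqxx.
Qed.

Lemma R_swap u v : u \in X -> v != o -> v != u -> v != lab u ->
  (lab u, v) \in R -> (v, lab u) \in R -> False.
Proof.
move=> uX vo vu vw r1 r2; have [uo k _] := XP uX; have [wo e uw] := labP uX.
have /(R_inj r1 r2) [/eqP] := pair_swap wo uw k e vo vu vw (R_fresh r1) (R_fresh r2)
   (@R_ne (lab u, v) u uX wo r1) (@R_ne (v, lab u) u uX vo r2).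
by rewrite eq_sym (negbTE vw).
Qed.

Lemma R_ow u : u \in X -> (lab u, u) \in R -> (o, lab u) \in R -> False.
Proof.
move=> uX r1 r2; have [uo k _] := XP uX; have [wo e uw] := labP uX.
have /(R_inj r1 r2) [/eqP] := cycle_ow uo wo uw e (R_fresh r1) (R_fresh r2).
by rewrite (negbTE wo).
Qed.

Lemma R_wo u : u \in X -> (u, lab u) \in R -> (lab u, o) \in R -> False.
Proof.
move=> uX r1 r2; have [uo k _] := XP uX; have [wo e uw] := labP uX.
have /(R_inj r1 r2) [/eqP] := cycle_wo uo wo uw k (R_fresh r1) (R_fresh r2)
   (@R_ne (u, lab u) u uX uo r1) (@R_ne (lab u, o) u uX wo r2).
by rewrite (negbTE uw).
Qed.

(** [Q] holds the vertices that can be freed, with [o] free from the start; [Z] holds the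
    off-diagonal cells that meet one of their rows or columns. *)
Let Q := o |: lab @: X.
Let Z := [set a : I * I | (a.1 != a.2) && ((a.1 \in Q) || (a.2 \in Q))].

Lemma card_Q : #|Q| = #|X|.+1.
Proof.
rewrite cardsU1 card_in_imset ?add1n; last exact: lab_inj.
case: imsetP => // -[u uX e]; have [wo _ _] := labP uX.
by move: wo; rewrite -e eqxx.
Qed.

Let special a b := [exists u in X, (a == lab u) && (b == u)].

(** Sends a representing cell of [Z] to a cell of [Z] that represents nothing: to its mirror image
    if possible. Otherwise the pair is [{lab u, u}], and [(o, lab u)] or [(lab u, o)] is used,
    depending on the orientation. *)
Let h (c : I * I) : I * I :=
  if (c.2, c.1) \notin R then (c.2, c.1)
  else if special c.1 c.2 then (o, c.1) else (c.2, o).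

(* Both orders of a pair can be representatives only for {lab u, u}; then
   neither (o, lab u) nor (lab u, o) is one. *)
Lemma double_rep a b : (a, b) \in Z -> (a, b) \in R -> (b, a) \in R ->
  (special a b \/ special b a) /\ (a != o /\ b != o).
Proof.
rewrite inE /= => /andP[ab Qab] r1 r2.
have ao : a != o.
  by apply/eqP => e; move: r1 r2; rewrite e => r1 r2; apply: (R_two _ r1 r2); rewrite -e eq_sym.
have bo : b != o.
  by apply/eqP => e; move: r1 r2; rewrite e => r1 r2; apply: (R_two _ r2 r1); rewrite -e.
split=> //; move: Qab; rewrite !inE (negbTE ao) (negbTE bo) /=.
case/orP => /imsetP[u uX e]; [left|right]; apply/existsP; exists u; rewrite uX e eqxx /=.
  apply/negPn/negP => bu; apply: (R_swap uX bo bu _ _ _); rewrite -?e //; by rewrite eq_sym.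
apply/negPn/negP => bu; apply: (R_swap uX ao bu _ _ _); rewrite -?e //.
Qed.

Lemma h_spec a b : (a, b) \in Z -> (a, b) \in R ->
  [\/ h (a, b) = (b, a) /\ (b, a) \notin R,
     exists u, [/\ u \in X, a = lab u, b = u, (b, a) \in R & h (a, b) = (o, a)] |
     exists u, [/\ u \in X, b = lab u, a = u, (b, a) \in R & h (a, b) = (b, o)]].
Proof.
move=> z r; rewrite /h /=; case: ifPn => [|/negPn r']; first by constructor 1.
have [sp _] := double_rep z r r'.
case: ifPn => s; [constructor 2|constructor 3].
  by case/existsP: s => u /and3P[uX /eqP e1 /eqP e2]; exists u.
case: sp => [sp|]; first by rewrite sp in s.
by case/existsP => u /and3P[uX /eqP e1 /eqP e2]; exists u.
Qed.

Lemma card_R_Z : (#|R :&: Z|).*2 <= #|Z|.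
Proof.
have hinj : {in R :&: Z &, injective h}.
  move=> [a b] [c d] /setIP[r z] /setIP[r' z'].
  have lo u : u \in X -> lab u = o -> False by case/labP => /eqP.
  case: (h_spec z r) => [[-> n]|[u [uX ea eb rr ->]]|[u [uX eb ea rr ->]]];
  case: (h_spec z' r') => [[-> n']|[v [vX ec ed rr' ->]]|[v [vX ed ec rr' ->]]] E;
  have /= e1 := congr1 fst E; have /= e2 := congr1 snd E.
  - by rewrite e1 e2.
  (* If a mirror image met a substitute cell, the mirror image of that substitute would be a
     representative; the other three-cycle excludes this. *)
  - exfalso; apply: (R_wo vX); first by rewrite -ec -ed.
    by rewrite -ec -e1 -e2.
  - exfalso; apply: (R_ow vX); first by rewrite -ed -ec.
    by rewrite -ed -e1 -e2.
  - exfalso; apply: (R_wo uX); first by rewrite -ea -eb.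
    by rewrite -ea e1 e2.
  - by rewrite e2 eb ed; congr pair; apply: lab_inj; rewrite // -ea -ec.
  - by exfalso; apply: (lo v vX); rewrite -ed -e1.
  - exfalso; apply: (R_ow uX); first by rewrite -eb -ea.
    by rewrite -eb e1 e2.
  - by exfalso; apply: (lo u uX); rewrite -eb e1.
  - by rewrite e1 ea ec; congr pair; apply: lab_inj; rewrite // -eb -ed.
have sub : h @: (R :&: Z) \subset Z :\: R.
  apply/subsetP => _ /imsetP[[a b] /setIP[r z] ->].
  have /andP[ab Qab] : (a != b) && ((a \in Q) || (b \in Q)) by move: z; rewrite inE.
  have oQ : o \in Q by rewrite !inE eqxx.
  case: (h_spec z r) => [[-> n]|[u [uX ea eb rr ->]]|[u [uX eb ea rr ->]]].
  - by rewrite inE n inE /= eq_sym ab orbC.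
  - have [wo _ _] := labP uX; rewrite inE inE /= oQ andbT eq_sym {2}ea wo andbT.
    apply/negP => r2; apply: (R_ow uX); first by rewrite -ea -eb.
    by rewrite -ea.
  - have [wo _ _] := labP uX; rewrite inE inE /= oQ orbT andbT {2}eb wo andbT.
    apply/negP => r2; apply: (R_wo uX); first by rewrite -eb -ea.
    by rewrite -eb.
have := subset_leq_card sub; rewrite card_in_imset // => le.
by have := cardsID R Z; rewrite setIC; lia.
Qed.

Lemma card_offdiag (A : {set I}) :
  #|[set a : I * I | [&& a.1 != a.2, a.1 \in A & a.2 \in A]]| = #|A| * #|A|.-1.
Proof.
have -> : [set a : I * I | [&& a.1 != a.2, a.1 \in A & a.2 \in A]]
   = setX A A :\: [set (x, x) | x in A].
  apply/setP => -[a b]; rewrite !inE /=; case: (eqVneq a b) => [<-|ne] /=.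
    case aA: (a \in A); rewrite ?andbF //= andbT; symmetry; apply/negbTE/negPn.
    by apply/imsetP; exists a.
  have -> // : (a, b) \notin [set (x, x) | x in A].
  by apply/imsetP => -[x _ [e1 e2]]; move: ne; rewrite e1 e2 eqxx.
rewrite cardsD cardsX (setIidPr _); last first.
  by apply/subsetP => _ /imsetP[x xA ->]; rewrite inE /= xA.
rewrite card_imset => [|x y []//].
by case: #|A| => // k; rewrite mulnS; lia.
Qed.

(** Here [m] is the number of vertices outside [Q]. At most half of [Z] and at most all [m(m-1)]
    other off-diagonal cells are representatives; the symbols of [K] add [#|I| - 1]. *)
Theorem pair_count m : #|I| = (#|X| + m).+1 ->
  (#|symM|).*2 <= (#|I|.+2) * #|I|.-1 + m * m.-1.
Proof.
move=> cI.
have cK : #|K| = #|I|.-1.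
  by rewrite card_in_imset ?cardC1 //; exact: diagM.
have cR : #|R| = #|symM :\: K|.
  rewrite card_in_imset // => y z /setDP[yS _] /setDP[zS _] e.
  by rewrite -(repE yS) e repE.
have KS : K \subset symM.
  by apply/subsetP => _ /imsetP[v _ ->]; apply/imsetP; exists (v, v).
have cS : #|symM| = #|I|.-1 + #|R|.
  by rewrite cR -cK cardsD (setIidPr KS) subnKC // subset_leq_card.
pose O (A : {set I}) := [set a : I * I | [&& a.1 != a.2, a.1 \in A & a.2 \in A]].
have cQ : #|~: Q| = m by rewrite cardsCs setCK card_Q cI; lia.
have cO : #|O setT| = #|I| * #|I|.-1 by rewrite /O card_offdiag cardsT.
have cO2 : #|O (~: Q)| = m * m.-1 by rewrite /O card_offdiag cQ.
have eZ : Z = O setT :\: O (~: Q).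
  apply/setP => a; rewrite !inE; case: (a.1 == a.2) => //=.
  by rewrite andbT -negb_or negbK.
have sO : O (~: Q) \subset O setT by apply/subsetP => a; rewrite !inE => /andP[->].
have cZ : #|Z| + m * m.-1 = #|I| * #|I|.-1.
  by rewrite eZ cardsD (setIidPr sO) -cO2 subnK ?cO // -cO subset_leq_card.
have RD : #|R :\: Z| <= m * m.-1.
  rewrite -cO2; apply: subset_leq_card; apply/subsetP => -[a b] /setDP[r nz].
  have ab : a != b by apply: contraL r => /eqP ->; apply: R_diag.
  by move: nz; rewrite !inE /= ab /= negb_or.
have := card_R_Z; have := cardsID Z R; lia.
Qed.
End PairCount.

(** * Partial transversals *)

Section PartialTransversals.
Variables (I J Y : finType) (L : I -> J -> Y).
Implicit Types (T : {set I * J}) (c d : I * J).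

Definition latin := (forall i, injective (L i)) /\ (forall j, injective (L^~ j)).
Definition sym c := L c.1 c.2.
(** Every cell clashes with itself, which is why [pt] concludes [c == d]. *)
Definition clash c d := [|| c.1 == d.1, c.2 == d.2 | sym c == sym d].
Definition pt T := [forall c in T, forall d in T, clash c d ==> (c == d)].
Definition symset T := [set sym c | c in T].
Definition rows T := [set c.1 | c in T].
Definition cols T := [set c.2 | c in T].
Definition symbols := [set sym c | c : I * J].

Lemma ptP T : reflect {in T &, forall c d, clash c d -> c = d} (pt T).
Proof.
apply: (iffP forall_inP) => [h c d cT dT cl|h c cT].
  by have /forall_inP/(_ d dT) := h c cT; rewrite cl => /eqP.
by apply/forall_inP => d dT; apply/implyP => cl; apply/eqP/h.
Qed.

Lemma pt_sub T T' : T' \subset T -> pt T -> pt T'.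
Proof.
move=> /subsetP s /ptP h; apply/ptP => c d /s cT /s dT; exact: h.
Qed.

Lemma mem_rows T c : c \in T -> c.1 \in rows T.
Proof. by move=> cT; apply/imsetP; exists c. Qed.
Lemma mem_cols T c : c \in T -> c.2 \in cols T.
Proof. by move=> cT; apply/imsetP; exists c. Qed.
Lemma mem_symset T c : c \in T -> sym c \in symset T.
Proof. by move=> cT; apply/imsetP; exists c. Qed.

Lemma pt_row T : pt T -> {in T &, injective fst}.
Proof. by move=> /ptP h c d cT dT e; apply: h => //; rewrite /clash e eqxx. Qed.
Lemma pt_col T : pt T -> {in T &, injective snd}.
Proof. by move=> /ptP h c d cT dT e; apply: h => //; rewrite /clash e eqxx orbT. Qed.
Lemma pt_sym T : pt T -> {in T &, injective sym}.
Proof. by move=> /ptP h c d cT dT e; apply: h => //; rewrite /clash e eqxx !orbT. Qed.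

Lemma card_rows T : pt T -> #|rows T| = #|T|.
Proof. by move=> p; rewrite card_in_imset //; exact: pt_row. Qed.
Lemma card_cols T : pt T -> #|cols T| = #|T|.
Proof. by move=> p; rewrite card_in_imset //; exact: pt_col. Qed.
Lemma card_symset T : pt T -> #|symset T| = #|T|.
Proof. by move=> p; rewrite card_in_imset //; exact: pt_sym. Qed.

Lemma pt_add T c : pt T -> c.1 \notin rows T -> c.2 \notin cols T ->
  sym c \notin symset T -> pt (c |: T) /\ #|c |: T| = #|T|.+1.
Proof.
move=> p nr nc ns; have cT : c \notin T by apply: contra nr; exact: mem_rows.
have H d : d \in T -> clash c d = false.
  move=> dT; apply/negbTE; rewrite /clash !negb_or; apply/and3P; split.
  - by apply: contraNneq nr => ->; exact: mem_rows.
  - by apply: contraNneq nc => ->; exact: mem_cols.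
  - by apply: contraNneq ns => ->; exact: mem_symset.
have clC d e : clash d e = clash e d by rewrite /clash !(eq_sym d.1, eq_sym d.2, eq_sym (sym d)).
split; last by rewrite cardsU1 cT.
apply/ptP => d e /setU1P[->|dT] /setU1P[->|eT] //.
- by rewrite H.
- by rewrite clC H.
- by have /ptP := p; apply.
Qed.

Lemma pt_swap T c d : pt T -> c \in T -> d.1 \notin rows T -> d.2 \notin cols T ->
  sym d = sym c ->
  let T' := d |: T :\ c in
  [/\ pt T', #|T'| = #|T|, symset T' = symset T & c.1 \notin rows T'].
Proof.
move=> p cT nr nc e T'.
have p1 : pt (T :\ c) by apply: pt_sub p; exact: subsetDl.
have sr : rows (T :\ c) \subset rows T by apply: imsetS; exact: subsetDl.
have sc : cols (T :\ c) \subset cols T by apply: imsetS; exact: subsetDl.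
have ns : sym d \notin symset (T :\ c).
  apply/imsetP => -[z /setD1P[zc zT]]; rewrite e => /(pt_sym p cT zT) ez.
  by rewrite ez eqxx in zc.
have [p2 cd] := pt_add p1 (contra (subsetP sr _) nr) (contra (subsetP sc _) nc) ns.
split=> //; first by rewrite cd (cardsD1 c T) cT.
  by rewrite /symset imsetU1 -/(symset _) e -[in RHS](setD1K cT) /symset imsetU1.
apply/imsetP => -[z /setU1P[->|/setD1P[zc zT]] e1].
  by rewrite -e1 mem_rows in nr.
by move: zc; rewrite (pt_row p cT zT e1) eqxx.
Qed.

Lemma row_cols_notin T c : pt T -> c \in T -> c.2 \notin cols (T :\ c).
Proof.
move=> p cT; apply/imsetP => -[z /setD1P[zc zT] e].
by move: zc; rewrite (pt_col p cT zT e) eqxx.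
Qed.

(* Woolbright's chain argument: the rows that can be freed by successively
   using the free columns grow by at least #|F| with each column. *)
Section Growth.
Variables (A : {set I}) (B : {set J}) (T : {set I * J}).
Hypothesis latinL : latin.
Hypothesis TAB : T \subset setX A B.
Hypothesis pT : pt T.
Hypothesis maxT : forall T', T' \subset setX A B -> pt T' -> #|T'| <= #|T|.

Let F := A :\: rows T.
Let G := B :\: cols T.

(** The last clause keeps the induction going: a cell of [T] whose row is not in [U] is still in
    [T'], so it can be swapped out next. *)
Definition freeable (G' : {set J}) (U : {set I}) r := exists T',
  [/\ T' \subset setX A B, pt T', #|T'| = #|T|, symset T' = symset T &
   [/\ r \notin rows T', cols T' \subset cols T :|: G' & forall c, c \in T -> c \notin T' -> c.1 \in U]].

Lemma growth_step (G' : {set J}) : G' \subset G ->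
  exists U : {set I}, [/\ F \subset U, U \subset A, #|G'|.+1 * #|F| <= #|U| &
   forall r, r \in U -> freeable G' U r].
Proof.
elim: {G'}#|G'| {-2}G' (erefl #|G'|) => [|k IH] G' cG sG.
  exists F; split=> //; first exact: subsetDl.
    by rewrite cG mul1n.
  move=> r /setDP[_ rT]; exists T; split=> //; split=> //; first by rewrite subsetUl.
  by move=> c cT; rewrite cT.
have [g gG'] : exists g, g \in G' by apply/set0Pn; rewrite -card_gt0 cG.
have cG1 : #|G' :\ g| = k by move: cG; rewrite (cardsD1 g) gG' => -[].
have sG1 : G' :\ g \subset G by apply: subset_trans sG; exact: subsetDl.
have [U [FU UA cU freeU]] := IH _ cG1 sG1.
have gG : g \in G by apply: (subsetP sG).
have /setDP[gB gT] := gG.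
(* Otherwise [(r, g)] could be added to the [T'] that misses row [r], against maximality. *)
have lab r : r \in U -> exists2 c, c \in T & L r g = sym c.
  move=> rU; have [T' [sT' pT' cT' eT' [rT' colT' _]]] := freeU r rU.
  have gT' : g \notin cols T'.
    apply/negP => /(subsetP colT'); rewrite !inE eqxx orbF /= => h.
    by rewrite h in gT.
  case: (boolP (L r g \in symset T)) => [/imsetP[c cT ->]|n]; first by exists c.
  rewrite -eT' in n; have [p1 c1] := @pt_add T' (r, g) pT' rT' gT' n.
  have : (r, g) |: T' \subset setX A B.
    by rewrite subUset sT' andbT sub1set inE /= gB (subsetP UA).
  by move=> /maxT/(_ p1); rewrite c1 cT' ltnn.
pose lb r : I * J := odflt (r, g) [pick c in T | sym c == L r g].
have lbP r : r \in U -> lb r \in T /\ sym (lb r) = L r g.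
  move=> /lab[c cT e]; rewrite /lb; case: pickP => [d /andP[dT /eqP] //|/(_ c)].
  by rewrite cT e eqxx.
(* Column [g] is Latin, so [V] has as many rows as [U]; they all meet [T], hence avoid [F]. So
   [F :|: V] has [#|F|] more rows than [U]. *)
pose V := [set (lb r).1 | r in U].
have cV : #|V| = #|U|.
  rewrite card_in_imset // => r s /lbP[t1 e1] /lbP[t2 e2] e.
  have [_ lc] := latinL; apply: (lc g); rewrite /= -e1 -e2.
  by rewrite (pt_row pT t1 t2 e).
have VT : V \subset rows T.
  by apply/subsetP => _ /imsetP[r /lbP[t _] ->]; exact: mem_rows.
have rA : rows T \subset A.
  by apply/subsetP => _ /imsetP[c /(subsetP TAB) + ->]; rewrite inE => /andP[].
exists (U :|: V); split.
- by apply: subset_trans FU _; exact: subsetUl.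
- by rewrite subUset UA; apply: subset_trans rA.
- have dFV : F :&: V = set0.
    apply/setP => r; rewrite !inE; apply/negP => /andP[/andP[n _] /(subsetP VT) h].
    by rewrite h in n.
  have : F :|: V \subset U :|: V by exact: setSU.
  move/subset_leq_card; rewrite cardsU dFV cards0 subn0 cV.
  by apply: leq_trans; rewrite cG mulSn leq_add2l -cG1.
- move=> r; rewrite inE; case: (boolP (r \in U)) => [rU _|rU /= /imsetP[s sU er]].
    have [T' [sT' pT' cT' eT' [rT' colT' h]]] := freeU r rU.
    exists T'; split=> //; split=> //.
      by apply: subset_trans colT' _; apply: setUS; exact: subsetDl.
    by move=> c cT cT''; rewrite inE h.
  have [T' [sT' pT' cT' eT' [rT' colT' h]]] := freeU s sU.
  have [lT le] := lbP s sU.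
  have lT' : lb s \in T'.
    by apply/negPn/negP => n; rewrite er (h _ lT n) in rU.
  have gT' : g \notin cols T'.
    apply/negP => /(subsetP colT'); rewrite !inE eqxx orbF /= => hh.
    by rewrite hh in gT.
  have [q1 q2 q3 q4] := @pt_swap T' (lb s) (s, g) pT' lT' rT' gT' (esym le).
  exists ((s, g) |: T' :\ lb s); split=> //.
  + rewrite subUset sub1set inE /= gB (subsetP UA) //=.
    by apply: subset_trans sT'; exact: subsetDl.
  + by rewrite q2.
  + by rewrite q3.
  split; first by rewrite er.
    apply/subsetP => _ /imsetP[c /setU1P[->|/setD1P[_ cT1]] ->] /=.
      by rewrite !inE gG' orbT.
    have := subsetP colT' _ (mem_cols cT1); rewrite !inE => /orP[->//|/andP[_ ->]].
    by rewrite orbT.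
  move=> c cT; rewrite !inE negb_or negb_and negbK => /andP[_ /orP[/eqP->|n]].
    by apply/orP; right; apply/imsetP; exists s.
  by rewrite (h c cT n).
Qed.

Lemma growth : #|G|.+1 * #|F| <= #|A|.
Proof.
have [U [_ UA le _]] := growth_step (subxx G).
by apply: leq_trans le _; exact: subset_leq_card.
Qed.
End Growth.
End PartialTransversals.

(** * Two successive swaps in a largest partial transversal *)

Section DoubleSwap.
Variables (I J Y : finType) (L : I -> J -> Y).
Variables (A : {set I}) (B : {set J}) (T : {set I * J}) (j0 : J).
Hypothesis latinL : latin L.
Hypothesis TAB : T \subset setX A B.
Hypothesis pT : pt L T.
Hypothesis maxT : forall T' : {set I * J}, T' \subset setX A B -> pt L T' -> #|T'| <= #|T|.
Hypothesis j0B : j0 \in B.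
Hypothesis j0T : j0 \notin cols T.

Let F := A :\: rows T.

Lemma free_cell (T' : {set I * J}) r g : T' \subset setX A B -> pt L T' -> #|T'| = #|T| ->
  symset L T' = symset L T -> r \in A -> g \in B -> r \notin rows T' -> g \notin cols T' ->
  L r g \in symset L T.
Proof.
move=> sT' pT' cT' eT' rA gB rT' gT'; apply/negPn/negP; rewrite -eT' => n.
have [p1 c1] := @pt_add _ _ _ L T' (r, g) pT' rT' gT' n.
have : (r, g) |: T' \subset setX A B.
  by rewrite subUset sT' andbT sub1set inE /= gB rA.
by move=> /maxT/(_ p1); rewrite c1 cT' ltnn.
Qed.

Let cell r g : I * J := odflt (r, g) [pick c in T | sym L c == L r g].

Lemma cellP r g : L r g \in symset L T -> cell r g \in T /\ sym L (cell r g) = L r g.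
Proof.
case/imsetP => c cT e; rewrite /cell; case: pickP => [d /andP[dT /eqP] //|/(_ c)].
by rewrite cT e eqxx.
Qed.

(** Row [i] takes the free column [j0] and pushes out [c1 i]; row [i'] then takes the column just
    freed and pushes out [c2 i i']. *)
Let c1 i := cell i j0.
Let c2 i i' := cell i' (c1 i).2.
Let old_rows (c : I * J) := [set r | L r c.2 \in symset L T].

Lemma free_rowP i : i \in F -> i \in A /\ i \notin rows T.
Proof. by case/setDP. Qed.

Lemma c1P i : i \in F -> c1 i \in T /\ sym L (c1 i) = L i j0.
Proof. by case/free_rowP => iA iT; apply: cellP; exact: (free_cell TAB pT erefl erefl). Qed.

Lemma c1_inj : {in F &, injective c1}.
Proof.
have [_ lc] := latinL.
by move=> i k /c1P[_ e1] /c1P[_ e2] e; apply: (lc j0); rewrite /= -e1 -e2 e.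
Qed.

Let T1 i := (i, j0) |: T :\ c1 i.

Lemma T1P i : i \in F -> [/\ T1 i \subset setX A B, pt L (T1 i), #|T1 i| = #|T|,
  symset L (T1 i) = symset L T & [/\ (c1 i).1 \notin rows (T1 i), (c1 i).2 \notin cols (T1 i)
    & forall r, r \in F -> r != i -> r \notin rows (T1 i)]].
Proof.
move=> iF; have [iA iT] := free_rowP iF; have [cT ce] := c1P iF.
have [q1 q2 q3 q4] := @pt_swap _ _ _ L T (c1 i) (i, j0) pT cT iT j0T (esym ce).
split=> //.
  rewrite subUset sub1set inE /= iA j0B /=.
  by apply: subset_trans TAB; exact: subsetDl.
split=> //.
  apply/imsetP => -[z /setU1P[->|zT] e] /=.
    by move: j0T; rewrite -[j0]/((i, j0).2) -e mem_cols.
  by have := row_cols_notin pT cT; rewrite e mem_cols.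
move=> r /free_rowP[_ rT] ri; apply/imsetP => -[z /setU1P[->|/setD1P[_ zT]] e].
  by rewrite e eqxx in ri.
by rewrite e mem_rows in rT.
Qed.

Lemma c2P i i' : i \in F -> i' \in F -> i' != i ->
  [/\ c2 i i' \in T, sym L (c2 i i') = L i' (c1 i).2 & c2 i i' != c1 i].
Proof.
move=> iF i'F ne; have [s1 p1 k1 e1 [a1 b1 d1]] := T1P iF.
have [cT ce] := c1P iF; have [i'A i'T] := free_rowP i'F.
have cB : (c1 i).2 \in B by have := subsetP TAB _ cT; rewrite inE => /andP[].
have [h1 h2] := cellP (free_cell s1 p1 k1 e1 i'A cB (d1 _ i'F ne) b1).
split=> //; apply: contraNneq i'T => e; move: h2; rewrite -/(c2 i i') e.
have [_ lc] := latinL; move=> /(lc (c1 i).2) <-; exact: mem_rows.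
Qed.

(** After both swaps the column of [c2 i i'] is free, and so is each of the rows [r] described. By
    maximality the cell where they meet carries a symbol of [T]. *)
Lemma two_step i i' r : i \in F -> i' \in F -> i' != i ->
  ((r \in F) && (r != i) && (r != i')) || (r == (c1 i).1) -> r \in old_rows (c2 i i').
Proof.
move=> iF i'F ne rP; have [s1 p1 k1 e1 [a1 b1 d1]] := T1P iF.
have [cT ce] := c1P iF; have [i'A i'T] := free_rowP i'F; have [dT de dne] := c2P iF i'F ne.
have dT1 : c2 i i' \in T1 i by rewrite !inE dne dT orbT.
have [q1 q2 q3 q4] := @pt_swap _ _ _ L (T1 i) (c2 i i') (i', (c1 i).2) p1 dT1
  (d1 _ i'F ne) b1 (esym de).
have AB c : c \in T -> (c.1 \in A) && (c.2 \in B).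
  by move=> h; have := subsetP TAB _ h; rewrite inE.
have /andP[cA cB] := AB _ cT; have /andP[dA dB] := AB _ dT.
have rr : r \notin rows (T1 i) /\ r != i'.
  case/orP: rP => [/andP[/andP[rF ri] ri']|/eqP ->]; first by split=> //; exact: d1.
  by split=> //; apply: contraNneq i'T => <-; exact: mem_rows.
have rA : r \in A.
  by case/orP: rP => [/andP[/andP[/free_rowP[]]]|/eqP ->].
rewrite inE; apply: (free_cell _ q1 _ _ rA dB).
- rewrite subUset sub1set inE /= i'A cB /=.
  by apply: subset_trans s1; exact: subsetDl.
- by rewrite q2.
- by rewrite q3.
- apply/imsetP => -[z /setU1P[->|/setD1P[_ zT]] e].
    by case: rr => _; rewrite e eqxx.
  by case: rr; rewrite e mem_rows.
- apply/imsetP => -[z /setU1P[->|zT] e].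
    by move: dne; rewrite (pt_col pT dT cT e) eqxx.
  by have := row_cols_notin p1 dT1; rewrite e mem_cols.
Qed.

Lemma card_old_rows c : #|old_rows c| <= #|T|.
Proof.
rewrite -(card_symset pT); have [_ lc] := latinL.
rewrite -(card_imset _ (lc c.2)); apply: subset_leq_card.
by apply/subsetP => _ /imsetP[r + ->]; rewrite inE.
Qed.

(** Only the first row of a swap pair is recorded, since [i] and [c] determine the second. *)
Let P c := [set i in F | [exists i' in F, (i' != i) && (c2 i i' == c)]].

Lemma swapsP c i : i \in P c -> i \in F /\ exists i', [/\ i' \in F, i' != i & c2 i i' = c].
Proof.
rewrite inE => /andP[iF /existsP[i' /and3P[h1 h2 /eqP h3]]].
by split=> //; exists i'.
Qed.

(** The column of [c] has old symbols in all rows of [F], in the rows of the cells [c1 i] with [i]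
    in [P c], and in the row of [c]; these are distinct. With three choices of [i], two differ from
    a given row [z] of [F], and [z] cannot be the second row for both. *)
Lemma card_swaps c : c \in T -> 2 < #|P c| -> (#|F| + #|P c|).+1 <= #|T|.
Proof.
move=> cT big; apply: leq_trans (card_old_rows c); have [lr lc] := latinL.
have FR : F \subset old_rows c.
  apply/subsetP => z zF.
  have : 1 < #|P c :\ z| by move: big; rewrite (cardsD1 z (P c)); lia.
  case/card_gt1P => i [k [/setD1P[iz /swapsP[iF [i' [i'F i'i ei]]]]
    /setD1P[kz /swapsP[kF [k' [k'F k'k ek]]]] ik]].
  case: (eqVneq z i') => [e|n]; last first.
    by rewrite -ei; apply: two_step; rewrite // zF n eq_sym iz.
  case: (eqVneq z k') => [e'|n]; last first.
    by rewrite -ek; apply: two_step; rewrite // zF n eq_sym kz.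
  exfalso; move: ik; rewrite -(inj_in_eq c1_inj) //.
  have [_ h1 _] := c2P iF i'F i'i; have [_ h2 _] := c2P kF k'F k'k.
  move: h2; rewrite ek -ei h1 -e -e' => /lr h; have [t1 _] := c1P iF; have [t2 _] := c1P kF.
  by rewrite (pt_col pT t1 t2 h) eqxx.
pose V := [set (c1 i).1 | i in P c].
have cV : #|V| = #|P c|.
  rewrite card_in_imset // => i k /swapsP[iF _] /swapsP[kF _] e; apply: c1_inj => //.
  have [t1 _] := c1P iF; have [t2 _] := c1P kF; exact: (pt_row pT t1 t2 e).
have VR : V \subset old_rows c.
  apply/subsetP => _ /imsetP[i /swapsP[iF [i' [i'F ne <-]]] ->].
  by apply: two_step; rewrite // eqxx orbT.
have VT : V \subset rows T.
  by apply/subsetP => _ /imsetP[i /swapsP[/c1P[t _] _] ->]; exact: mem_rows.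
have cV1 : c.1 \notin V.
  apply/imsetP => -[i /swapsP[iF [i' [i'F ne e]]] e1].
  have [t1 _] := c1P iF; have [_ _ h] := c2P iF i'F ne.
  by move: h; rewrite e (pt_row pT cT t1 e1) eqxx.
have cR : c.1 \in old_rows c by rewrite inE; exact: mem_symset.
have dis : F :&: (c.1 |: V) = set0.
  apply/setP => r; rewrite in_set0; apply/negP => /setIP[/free_rowP[_ n] /setU1P[e|/(subsetP VT) h]].
    by rewrite e mem_rows in n.
  by rewrite h in n.
have : F :|: (c.1 |: V) \subset old_rows c by rewrite !subUset FR VR sub1set cR.
by move/subset_leq_card; rewrite cardsU dis cards0 subn0 cardsU1 cV1 cV add1n addnS.
Qed.

Lemma double_swap :
  #|F| * #|F|.-1 <= 2 * #|T| \/ #|F| * #|F|.-1 + #|F|.+1 * #|T| <= #|T| * #|T|.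
Proof.
(* Ordered pairs of distinct free rows are counted by the cell that they push out last. *)
have key : #|F| * #|F|.-1 <= \sum_(c in T) #|P c|.
  pose D := [set x : I * I | [&& x.1 != x.2, x.1 \in F & x.2 \in F]].
  have <- : #|D| = #|F| * #|F|.-1 by exact: card_offdiag.
  pose g (x : I * I) := (c2 x.1 x.2, x.1).
  have ginj : {in D &, injective g}.
    move=> [i i'] [k k']; rewrite !(in_set (fun x : I * I => _)) /= => /and3P[n1 iF i'F] /and3P[n2 kF k'F] [e e'].
    subst k; congr pair; have [_ lc] := latinL; apply: (lc (c1 i).2).
    have [_ h1 _] := c2P iF i'F ltac:(by rewrite eq_sym).
    have [_ h2 _] := c2P iF k'F ltac:(by rewrite eq_sym).
    by rewrite /= -h1 -h2 e.
  rewrite -(card_in_imset ginj).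
  have -> : \sum_(c in T) #|P c| = #|[set x : (I * J) * I | (x.1 \in T) && (x.2 \in P x.1)]|.
    rewrite -sum1dep_card -(pair_big_dep (fun c => c \in T) (fun c i => i \in P c) (fun _ _ => 1)) /=.
    by apply: eq_bigr => c _; rewrite sum1_card.
  apply: subset_leq_card; apply/subsetP => _ /imsetP[[i i'] + ->].
  rewrite (in_set (fun x : I * I => _)) /= => /and3P[n1 iF i'F].
  have ne : i' != i by rewrite eq_sym.
  have [h1 _ _] := c2P iF i'F ne; rewrite in_set h1 /= in_set iF /=.
  by apply/existsP; exists i'; rewrite i'F ne eqxx.
case: (boolP [exists c in T, 2 < #|P c|]) => [/existsP[c0 /andP[c0T big0]]|/existsPn none].
  right.
  (* A single cell with three swaps already gives [#|F| + 4 <= #|T|], which settles the cells with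
     at most two. *)
  have le c : c \in T -> #|P c| + #|F|.+1 <= #|T|.
    move=> cT; case: (ltnP 2 #|P c|) => [/(card_swaps cT)|sm]; first by lia.
    by have := card_swaps c0T big0; lia.
  have : \sum_(c in T) (#|P c| + #|F|.+1) <= \sum_(c in T) #|T| by apply: leq_sum => c /le.
  rewrite big_split /= !sum_nat_const [X in _ + X <= _]mulnC.
  by apply: leq_trans; rewrite leq_add2r; exact: key.
left; apply: leq_trans key _; have : \sum_(c in T) #|P c| <= \sum_(c in T) 2.
  by apply: leq_sum => c cT; have := none c; rewrite cT -leqNgt.
by rewrite sum_nat_const; lia.
Qed.
End DoubleSwap.

(** * Old symbols in the columns of a largest partial transversal *)

Section Kappa.
Variables (I J Y : finType) (L : I -> J -> Y) (B : {set J}) (t : nat).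
Hypothesis latinL : latin L.
Hypothesis cB : #|B| = t.+1.
Let D := setX [set: I] B.
Hypothesis maxB : forall T : {set I * J}, T \subset D -> pt L T -> #|T| <= t.
Hypothesis exB : exists2 T : {set I * J}, T \subset D & pt L T /\ #|T| = t.

Let kk (T : {set I * J}) (g : J) := #|[set r | L r g \in symset L T]|.

(** [k] is the least number of old symbols in the missed column, over all largest partial
    transversals. The missed column contributes [k], each of the [#|I| - k] columns that a swap can
    free contributes at least [k], and every other column at least 1. *)
Lemma kappa_count : exists (T : {set I * J}) k, [/\ T \subset D, pt L T, #|T| = t &
  [/\ k <= t, #|I| <= k + t, k <= #|I| & k * (#|I| - k).+1 + t <= \sum_(g in B) kk T g + (#|I| - k)]].
Proof.
have [lr lc] := latinL.
pose st (x : {set I * J} * J) := [&& x.1 \subset D, pt L x.1, #|x.1| == t, x.2 \in B & x.2 \notin cols x.1].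
have [T0 [sT0 [pT0 cT0]]] := exB.
have [g0 g0B g0T] : exists2 g, g \in B & g \notin cols T0.
  apply/subsetPn; apply/negP => /subset_leq_card; rewrite cB (card_cols pT0) cT0; lia.
have st0 : st (T0, g0) by rewrite /st /= sT0 pT0 cT0 eqxx g0B g0T.
pose x := [arg min_(x < (T0, g0) | st x) kk x.1 x.2].
have [] : st x /\ forall y, st y -> kk x.1 x.2 <= kk y.1 y.2.
  by rewrite /x; case: arg_minnP.
case: x => T j /and5P[/= sT pT /eqP cT jB jT] minT.
have mxT (T' : {set I * J}) : T' \subset setX setT B -> pt L T' -> #|T'| <= #|T| by rewrite cT; exact: maxB.
exists T, (kk T j); split=> //.
have kt g : kk T g <= t.
  rewrite /kk -cT -(card_symset pT) -(card_imset _ (lc g)); apply: subset_leq_card.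
  by apply/subsetP => _ /imsetP[r + ->]; rewrite inE.
have free r : r \notin rows T -> L r j \in symset L T.
  by move=> rT; exact: (free_cell mxT sT pT erefl erefl (in_setT r) jB rT jT).
pose W := [set r | L r j \notin symset L T].
have cW : #|W| = #|I| - kk T j.
  have -> : W = ~: [set r | L r j \in symset L T] by apply/setP => r; rewrite !inE.
  by rewrite cardsCs setCK.
have kI : kk T j <= #|I| by exact: max_card.
have WT : W \subset rows T.
  by apply/subsetP => r; rewrite inE; apply: contraR; exact: free.
have WI : #|W| <= t by rewrite -cT -(card_rows pT) subset_leq_card.
split=> //; first by rewrite -leq_subLR -cW.
have AB c : c \in T -> c.2 \in B.
  by move=> h; have := subsetP sT _ h; rewrite inE => /andP[].
pose TW := [set c in T | c.1 \in W].
have cTW : #|TW| = #|W|.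
  have -> : W = [set c.1 | c in TW].
    apply/setP => r; apply/idP/imsetP => [rW|[c]]; last by rewrite inE => /andP[_ h] ->.
    have /imsetP[c cT' e] := subsetP WT _ rW; exists c => //.
    by rewrite inE cT' -e.
  rewrite card_in_imset // => c d; rewrite !inE => /andP[h _] /andP[h' _].
  exact: (pt_row pT).
(* Swapping in a cell of column j with a symbol outside T keeps all but one symbol of T,
   so the minimality of T applies to the column that becomes free. *)
have big c : c \in TW -> kk T j <= kk T c.2.
  rewrite inE => /andP[cT' cW']; rewrite inE in cW'.
  have p1 : pt L (T :\ c) by apply: pt_sub pT; exact: subsetDl.
  have n1 : c.1 \notin rows (T :\ c).
    apply/imsetP => -[z /setD1P[zc zT] e].
    by move: zc; rewrite (pt_row pT cT' zT e) eqxx.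
  have n2 : j \notin cols (T :\ c).
    by apply: contra jT => /imsetP[z /setD1P[_ zT] ->]; exact: mem_cols.
  have n3 : L c.1 j \notin symset L (T :\ c).
    by apply: contra cW' => /imsetP[z /setD1P[_ zT] ->]; exact: mem_symset.
  have [p2 c2] := @pt_add _ _ _ L (T :\ c) (c.1, j) p1 n1 n2 n3.
  have : st ((c.1, j) |: T :\ c, c.2).
    apply/and5P; split=> //=.
    - rewrite subUset sub1set !inE /= jB /=.
      by apply: subset_trans sT; exact: subsetDl.
    - by rewrite c2 -cT (cardsD1 c T) cT'.
    - exact: AB.
    apply/imsetP => -[z /setU1P[->|zT] e] /=.
      by move: jT; rewrite -[j]/((c.1, j).2) -e mem_cols.
    by have := row_cols_notin pT cT'; rewrite e mem_cols.
  move/minT => /= le; apply: leq_trans le _.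
  rewrite /kk; set T' := _ |: _.
  have eS : symset L T' = L c.1 j |: symset L (T :\ c) by rewrite /symset imsetU1.
  have own : sym L c \in symset L T by exact: mem_symset.
  have nown : sym L c \notin symset L T'.
    rewrite eS; apply/negP => /setU1P[e|/imsetP[z /setD1P[zc zT] e]].
      by move: cW'; rewrite -e own.
    by move: zc; rewrite (pt_sym pT cT' zT e) eqxx.
  (* The new symbol occupies at most one cell of this column, while the cell [c] itself no longer
     counts; so the number of old symbols does not rise. *)
  have sub : [set r | L r c.2 \in symset L T'] \subset
     [set r | L r c.2 == L c.1 j] :|: ([set r | L r c.2 \in symset L T] :\ c.1).
    apply/subsetP => r; rewrite in_set => h; rewrite in_setU in_setD1 !in_set.
    case: (boolP (r == c.1)) h => [/eqP -> h|_]; first by move: nown; rewrite /sym h.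
    rewrite eS in_setU1 => /orP[-> //|/imsetP[z /setD1P[_ zT] ->]].
    by rewrite mem_symset // orbT.
  apply: leq_trans (subset_leq_card sub) _.
  apply: leq_trans (leq_card_setU _ _) _.
  have le1 : #|[set r | L r c.2 == L c.1 j]| <= 1.
    apply/card_le1P => r; rewrite inE => /eqP e r'; rewrite !inE.
    apply/eqP/eqP => [e'|-> //]; apply: (lc c.2); rewrite /= e e' //.
  have : c.1 \in [set r | L r c.2 \in symset L T] by rewrite inE.
  by move=> h; rewrite [X in _ <= X](cardsD1 c.1) h leq_add2r.
have small c : c \in T -> 1 <= kk T c.2.
  move=> cT'; rewrite card_gt0; apply/set0Pn; exists c.1; rewrite inE.
  exact: mem_symset.
have eB : B = j |: cols T.
  apply/eqP; rewrite eq_sym eqEcard subUset sub1set jB /=; apply/andP; split.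
    by apply/subsetP => _ /imsetP[c /AB h ->].
  by rewrite cardsU1 jT (card_cols pT) cT cB.
rewrite eB big_setU1 //= big_imset /=; last exact: (pt_col pT).
rewrite (bigID (fun c => c.1 \in W)) /=.
have h1 : #|W| * kk T j <= \sum_(c in T | c.1 \in W) kk T c.2.
  rewrite -cTW -sum_nat_const; rewrite [X in _ <= X](eq_bigl (mem TW)); last by move=> c; rewrite /= !inE.
  by apply: leq_sum => c; exact: big.
have h2 : t <= \sum_(c in T | c.1 \notin W) kk T c.2 + #|W|.
  have eTW : T :&: TW = TW by apply/setIidPr/subsetP => c; rewrite inE => /andP[].
  have eD : [set c | (c \in T) && (c.1 \notin W)] = T :\: TW.
    by apply/setP => c; rewrite in_setD in_set [in RHS]in_set; case: (c \in T); rewrite ?andbF //= andbT.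
  rewrite -cT -(cardsID TW T) eTW cTW addnC leq_add2r -eD -sum1dep_card.
  by apply: leq_sum => c /andP[cT' _]; exact: small.
rewrite -cW mulnS [_ * #|W|]mulnC -!addnA leq_add2l; exact: leq_add h1 h2.
Qed.
End Kappa.

(** * Single cells and full lines *)

Section Lines.
Variables (I J Y : finType) (L : I -> J -> Y).
Implicit Types (T : {set I * J}) (c d : I * J).

Definition single c := [forall d, (sym L d == sym L c) ==> (d == c)].
Definition full_rows := [set i | [forall j, single (i, j)]].
Definition full_cols := [set j | [forall i, single (i, j)]].
(** The symbols that vanish when row [i] and column [j] are deleted. *)
Definition lost i j := [set y in symbols L | [forall c, (sym L c == y) ==> ((c.1 == i) || (c.2 == j))]].

Lemma singleP c : reflect (forall d, sym L d = sym L c -> d = c) (single c).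
Proof.
apply: (iffP forallP) => h d; first by move=> /eqP e; have := h d; rewrite e => /eqP.
by apply/implyP => /eqP /h ->.
Qed.

Lemma full_rowP i j : i \in full_rows -> single (i, j).
Proof. by rewrite inE => /forallP. Qed.
Lemma full_colP i j : j \in full_cols -> single (i, j).
Proof. by rewrite inE => /forallP. Qed.

Lemma lostP i j y : reflect (y \in symbols L /\ forall c, sym L c = y -> c.1 = i \/ c.2 = j)
  (y \in lost i j).
Proof.
rewrite inE; apply: (iffP andP) => -[h1 h2]; split=> //.
  move=> c /eqP e; have /forallP/(_ c) := h2; rewrite e.
  by case/orP => /eqP; [left|right].
by apply/forallP => c; apply/implyP => /eqP /h2 [] ->; rewrite eqxx ?orbT.
Qed.

Lemma mem_symbols c : sym L c \in symbols L.
Proof. by apply/imsetP; exists c. Qed.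

Lemma pt_add_single T r g : pt L T -> single (r, g) -> r \notin rows T -> g \notin cols T ->
  pt L ((r, g) |: T) /\ #|(r, g) |: T| = #|T|.+1.
Proof.
move=> p /singleP s rT gT; apply: pt_add => //.
by apply/imsetP => -[d dT /esym/s e]; move: rT; rewrite -[r]/((r, g).1) -e mem_rows.
Qed.

(** A single cell never clashes by symbol, so greedy extension works: first cells of full columns
    cover all remaining non-full rows, then cells of full rows fill the rest. *)
Lemma complete_pt T : #|I| = #|J| -> T \subset setX (~: full_rows) (~: full_cols) ->
  pt L T -> #|I| <= #|T| + #|full_rows| + #|full_cols| ->
  exists T', pt L T' /\ #|T'| = #|I|.
Proof.
move=> cIJ sT pT big.
pose st T1 := [&& T \subset T1, T1 \subset setX (~: full_rows) setT, pt L T1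
  & T1 :\: T \subset setX setT full_cols].
have st0 : st T.
  rewrite /st subxx pT setDv sub0set !andbT /=; apply: subset_trans sT _.
  by apply/subsetP => c; rewrite !inE => /andP[->].
have [T1 []] : exists T1, st T1 /\ forall T', st T' -> #|T'| <= #|T1|.
  by exists [arg max_(T1 > T | st T1) #|T1|]; case: arg_maxnP.
move=> /and4P[TT1 s1 p1 d1] max1.
have rT1 : rows T1 \subset ~: full_rows.
  by apply/subsetP => _ /imsetP[c /(subsetP s1) + ->]; rewrite !inE => /andP[].
have cfr : #|~: full_rows| = #|I| - #|full_rows| by rewrite cardsCs setCK.
have eqr : rows T1 = ~: full_rows.
  apply/eqP; rewrite eqEcard rT1 /= leqNgt; apply/negP => lt.
  have [r rf rT] : exists2 r, r \in ~: full_rows & r \notin rows T1.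
    by apply/subsetPn; apply: contraL lt => /subset_leq_card; rewrite leqNgt.
  have [g gf gT] : exists2 g, g \in full_cols & g \notin cols T1.
    (* If all full columns were used, [T1] would have at least [#|T| + #|full_cols|] cells, enough
       to cover the non-full rows. *)
    apply/subsetPn; apply/negP => sub.
    have : full_cols \subset cols (T1 :\: T).
      apply/subsetP => g gf; have /imsetP[c cT1 e] := subsetP sub _ gf.
      apply/imsetP; exists c => //; rewrite inE cT1 andbT.
      by apply/negP => /(subsetP sT); rewrite !inE -e; move: gf; rewrite inE => ->; rewrite andbF.
    move=> /subset_leq_card; have := leq_imset_card (@snd I J) (mem (T1 :\: T)).
    rewrite -/(cols _) => h1 h2; have := leq_trans h2 h1.
    rewrite cardsD (setIidPr TT1); rewrite (card_rows p1) cfr in lt.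
    have arith (x y z u v : nat) : v <= x - y -> y <= x -> x < u - z -> u <= y + z + v -> False by clear; lia.
    by move=> h3; exact: (arith _ _ _ _ _ h3 (subset_leq_card TT1) lt big).
  have [p2 c2] := pt_add_single p1 (full_colP r gf) rT gT.
  have : st ((r, g) |: T1).
    apply/and4P; split=> //.
    - by apply: subset_trans TT1 _; exact: subsetUr.
    - by rewrite subUset s1 andbT sub1set inE rf in_setT.
    - apply/subsetP => c /setDP[/setU1P[->|cT] n]; first by rewrite inE gf in_setT.
      by apply: (subsetP d1); rewrite inE n.
  by move/max1; rewrite c2 ltnn.
pose st2 T2 := (T1 \subset T2) && pt L T2.
have st20 : st2 T1 by rewrite /st2 subxx.
have [T2 []] : exists T2, st2 T2 /\ forall T', st2 T' -> #|T'| <= #|T2|.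
  by exists [arg max_(T2 > T1 | st2 T2) #|T2|]; case: arg_maxnP.
move=> /andP[T12 p2] max2.
exists T2; split=> //; apply/eqP; rewrite eqn_leq -{1}(card_rows p2) max_card /= leqNgt.
apply/negP => lt.
have [r rT] : exists r, r \notin rows T2.
  apply/existsP; rewrite -negb_forall; apply/negP => /forallP all.
  by move: lt; rewrite -(card_rows p2) (eq_card (B := predT)) ?ltnn // => x; rewrite all.
have [g gT] : exists g, g \notin cols T2.
  apply/existsP; rewrite -negb_forall; apply/negP => /forallP all.
  by move: lt; rewrite -(card_cols p2) cIJ (eq_card (B := predT)) ?ltnn // => x; rewrite all.
have rf : r \in full_rows.
  apply: contraR rT => n; have : r \in rows T1 by rewrite eqr inE.
  by apply: (subsetP (imsetS _ T12)).
have [p3 c3] := pt_add_single p2 (full_rowP g rf) rT gT.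
have : st2 ((r, g) |: T2) by rewrite /st2 p3 andbT; apply: subset_trans T12 _; exact: subsetUr.
by move/max2; rewrite c3 ltnn.
Qed.

(** The relabelling of columns that puts a partial transversal on the diagonal, with [(i, j)] as the
    missing cell. *)
Lemma state_fun T i j : pt L T -> #|T| = #|I|.-1 -> i \notin rows T -> j \notin cols T ->
  exists f : I -> J, [/\ injective f, f i = j & forall v, v != i -> (v, f v) \in T].
Proof.
move=> pT cT iT jT.
have er : rows T = ~: [set i].
  apply/eqP; rewrite eqEcard cardsC1 (card_rows pT) cT leqnn andbT.
  by apply/subsetP => r rT; rewrite !inE; apply: contraNneq iT => <-.
pose f v := if v == i then j else if [pick c in T | c.1 == v] is Some c then c.2 else j.
have fT v : v != i -> (v, f v) \in T.
  move=> vi; have /imsetP[c cT' e] : v \in rows T by rewrite er !inE.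
  rewrite /f (negbTE vi); case: pickP => [d /andP[dT /eqP <-]|/(_ c)].
    by rewrite -surjective_pairing.
  by rewrite cT' e eqxx.
have fi : f i = j by rewrite /f eqxx.
exists f; split=> // u v e.
have n w : w != i -> f w != j.
  by move=> wi; apply: contraNneq jT => <-; exact: (mem_cols (fT _ wi)).
case: (eqVneq u i) (eqVneq v i) e => [->|ui] [->|vi] e //.
- by have := n _ vi; rewrite -e fi eqxx.
- by have := n _ ui; rewrite e fi eqxx.
- by have [] := pt_col pT (fT _ ui) (fT _ vi) e.
Qed.

(** [q] counts the lost symbols of row [i] that [T] does not use; each of them frees a vertex, so
    the counting of representatives applies. *)
Lemma row_bound i j j' T : latin L -> #|I| = #|J| ->
  (forall T', pt L T' -> #|T'| < #|I|) ->
  single (i, j) -> pt L T -> #|T| = #|I|.-1 -> i \notin rows T -> j' \notin cols T -> j' != j ->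
  let A := lost i j :&: [set L i g | g : J] in
  let B := lost i j :&: [set L r j | r : I] in
  exists q m, [/\ #|I| = (q + m).+1, #|A| <= q.+1, #|A :\: B| < q &
    (#|symbols L|).*2 <= #|I|.+2 * #|I|.-1 + m * m.-1].
Proof.
move=> [lr lc] cIJ notr /singleP sg pT cT iT jT jj A B.
have [f [fI fi fT]] := state_fun pT cT iT jT.
pose M u v := L u (f v).
have rowM u : injective (M u) by move=> x y /lr /fI.
have colM v : injective (M^~ v) by move=> x y /lc.
have diagM : {in predC1 i &, injective (fun v => M v v)}.
  by move=> u v; rewrite !inE => ui vi e; have [] := pt_sym pT (fT _ ui) (fT _ vi) e.
have norb (s : {perm I}) : ~ injective (fun u => M u (s u)).
  move=> inj; pose T' := [set (u, f (s u)) | u : I].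
  have : pt L T'.
    apply/ptP => _ _ /imsetP[u _ ->] /imsetP[v _ ->].
    by case/or3P => /eqP; rewrite /sym /=; [move=> -> | move=> /fI/perm_inj -> | move=> /inj ->].
  by move=> /notr; rewrite card_imset ?ltnn // => u v [].
pose K := [set M v v | v in predC1 i].
have KT y : y \in K -> exists2 v, v != i & y = L v (f v).
  by case/imsetP => v; rewrite inE => vi ->; exists v.
have fsurj g : exists v, f v = g.
  have /imsetP[v _ ->] : g \in f @: setT; last by exists v.
  suff -> : f @: setT = setT by [].
  by apply/eqP; rewrite eqEcard subsetT /= card_imset // !cardsT cIJ.
have iK : L i j' \in K by rewrite -fi; exact: (base_in diagM norb).
pose X := [set u | (u != i) && (M i u \in A :\: K)].
(* A lost symbol of row [i] cannot stand at [(u, j')], because that cell lies neither in row [i] nor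
   in column [j]. *)
have XP u : u \in X -> [/\ u != i, M i u \notin K & M u i != M i u].
  rewrite in_set => /andP[ui /setDP[/setIP[/lostP[_ h] _] nK]]; split=> //.
  apply/eqP => e; have [] := h (u, f i) e => /= [e'|e'].
    by rewrite e' eqxx in ui.
  by move: jj; rewrite -fi e' eqxx.
have cX : #|A :\: K| <= #|X|.
  apply: leq_trans (leq_imset_card (M i) (mem X)); apply: subset_leq_card.
  apply/subsetP => y yA; have /setDP[/setIP[_ /imsetP[g _ e]] nK] := yA.
  have [v ev] := fsurj g; apply/imsetP; exists v; last by rewrite /M ev.
  rewrite in_set /M ev -e yA andbT; apply: contra nK => /eqP vi.
  by rewrite e -ev vi fi.
have ijK : L i j \notin K.
  apply/negP => /KT[v vi e]; have [e1] := sg (v, f v) (esym e).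
  by rewrite e1 eqxx in vi.
have AKv y : y \in A :&: K -> exists2 v, f v = j & y = L v j.
  move=> /setIP[/setIP[/lostP[_ h] _] /KT[v vi e]].
  have [/= e'|/= e'] := h (v, f v) (esym e); first by rewrite e' eqxx in vi.
  by exists v => //; rewrite e e'.
(* A lost symbol used by [T] is used outside row [i], hence in column [j], where [T] has at most one
   cell. *)
have AK1 : #|A :&: K| <= 1.
  apply/card_le1_eqP => y z /AKv[v ev ->] /AKv[w ew ->].
  by congr L; apply: fI; rewrite ev ew.
(* The symbol of the single cell [(i, j)] is in [A] and [B] but not in [K]; it provides the strict
   inequality for [A :\: B]. *)
have AB : L i j |: (A :\: B) \subset A :\: K.
  apply/subsetP => y /setU1P[->|/setDP[yA nB]]; rewrite inE.
    rewrite ijK /= in_setI; apply/andP; split; last by apply/imsetP; exists j.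
    by apply/lostP; split=> [|c /sg -> /=]; [exact: (mem_symbols (i, j))|left].
  rewrite yA andbT; apply: contra nB => yK.
  have [|v ev e] := AKv y; first by rewrite inE yA.
  have /setIP[yl _] := yA; rewrite in_setI yl /=; apply/imsetP; by exists v.
have nAB : L i j \notin A :\: B.
  rewrite !in_setD in_setI; apply/negP => /andP[/negP h /setIP[yl _]]; apply: h.
  by rewrite yl; apply/imsetP; exists i.
have cX2 : #|A :\: B| < #|X|.
  by apply: leq_trans cX; apply: leq_trans (subset_leq_card AB); rewrite cardsU1 nAB.
have XI : #|X| < #|I|.
  rewrite -cardsT; apply: proper_card; apply/properP; split; first exact: subsetT.
  by exists i; rewrite // in_set eqxx.
exists #|X|, (#|I| - #|X|).-1; have eI : #|I| = (#|X| + (#|I| - #|X|).-1).+1 by lia.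
split=> //.
  by have := cardsID K A; lia.
have -> : symbols L = [set M a.1 a.2 | a : I * I].
  apply/setP => y; apply/imsetP/imsetP => -[[a b] _ ->].
    by have [v ev] := fsurj b; exists (a, v); rewrite // /M /sym /= ev.
  by exists (a, f b).
exact: (pair_count rowM colM diagM norb XP eI).
Qed.

Lemma card_symbols_ge2 (D : {set I * J}) :
  (forall c, c \in D -> exists2 d, d \in D & d != c /\ sym L d = sym L c) ->
  (#|sym L @: D|).*2 <= #|D|.
Proof.
move=> h; rewrite -[X in _ <= X]sum1_card (partition_big_imset (sym L)) /=.
rewrite -muln2 -sum_nat_const; apply: leq_sum => _ /imsetP[c cD ->].
have [d dD [dc e]] := h c cD.
rewrite sum1dep_card (cardsD1 c) (cardsD1 d) !inE cD eqxx dD dc e eqxx /=; lia.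
Qed.

(** A lost symbol outside row [i] occurs at some [(r, j)] only, so that cell is single; column [j]
    is not full, so row [r] is. Row [i] itself is not counted twice, hence the strict bound. *)
Lemma lost_full i j : latin L -> i \in full_rows -> j \notin full_cols ->
  (forall r g, single (r, g) -> r \in full_rows \/ g \in full_cols) ->
  #|lost i j| < #|J| + #|full_rows|.
Proof.
move=> [lr lc] iF jF sF.
have sub : lost i j \subset [set L i g | g : J] :|: [set L r j | r in full_rows :\ i].
  apply/subsetP => y /lostP[/imsetP[[r g] _ ->] h]; rewrite in_setU.
  case: (eqVneq r i) => [->|ri]; first by apply/orP; left; apply/imsetP; exists g.
  apply/orP; right; have [/= e|/= e] := h (r, g) erefl; first by rewrite e eqxx in ri.
  apply/imsetP; exists r; last by rewrite e.
  rewrite in_setD1 ri /=; subst g.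
  have : single (r, j).
    apply/singleP => -[r' g'] e; have [/= e'|/= e'] := h (r', g') e; subst.
      have /singleP s := full_rowP g' iF.
      by have [e'] := s (r, j) (esym e); rewrite e' eqxx in ri.
    by congr pair; exact: (lc j).
  by case/sF => // h'; rewrite h' in jF.
apply: leq_ltn_trans (subset_leq_card sub) _; apply: leq_ltn_trans (leq_card_setU _ _) _.
have h1 : #|[set L i g | g : J]| <= #|J| by exact: leq_imset_card.
have h2 := leq_imset_card (L^~ j) (mem (full_rows :\ i)).
have h3 : #|full_rows| = #|full_rows :\ i|.+1 by rewrite (cardsD1 i full_rows) iF.
rewrite h3 addnS ltnS; exact: leq_add.
Qed.

(** A symbol neither in a full column nor in [T] fills at least two cells outside the full columns,
    and these cells are disjoint from those filled by the symbols of [T]. *)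
Lemma full_cols_count T : full_rows = set0 ->
  (forall r g, single (r, g) -> r \in full_rows \/ g \in full_cols) -> pt L T ->
  (#|symbols L|).*2 + \sum_(g in ~: full_cols) #|[set r | L r g \in symset L T]|
  <= (#|I| * #|full_cols|).*2 + (#|T|).*2 + #|I| * #|~: full_cols|.
Proof.
move=> f0 sF pT; set C := ~: full_cols.
pose D := [set c : I * J | (c.2 \in C) && (sym L c \notin symset L T)].
pose KC := [set c : I * J | (c.2 \in C) && (sym L c \in symset L T)].
have cKC : \sum_(g in C) #|[set r | L r g \in symset L T]| = #|KC|.
  rewrite -[RHS]sum1_card (partition_big (@snd I J) (mem C)) /=; last first.
    by move=> c; rewrite in_set => /andP[].
  apply: eq_bigr => g gC; rewrite sum1dep_card.
  rewrite -(card_imset _ (f := fun r => (r, g))) => [|r s []//].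
  apply: eq_card => -[r h]; rewrite [in RHS]in_set /= in_set /=.
  apply/imsetP/andP => [[s]|[/andP[_ k] /eqP e]]; last first.
    by exists r; rewrite ?in_set ?e // -e.
  by rewrite in_set => k [-> ->]; rewrite gC k.
have cDK : #|KC| + #|D| = #|I| * #|C|.
  rewrite -[#|I|]cardsT -cardsX -(cardsID KC (setX setT C)).
  have mK c : (c \in KC) = (c.2 \in C) && (sym L c \in symset L T) by rewrite in_set.
  have mD c : (c \in D) = (c.2 \in C) && (sym L c \notin symset L T) by rewrite in_set.
  congr (_ + _); apply: eq_card => -[r g].
    by rewrite in_setI in_setX in_setT mK /=; case: (g \in C).
  by rewrite in_setD in_setX in_setT mK mD /=; case: (g \in C); rewrite ?andbT ?andbF.
have D2 : (#|sym L @: D|).*2 <= #|D|.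
  apply: card_symbols_ge2 => -[r g]; rewrite in_set /= => /andP[gC n].
  have : ~~ single (r, g).
    by apply/negP => /sF; rewrite f0 in_set0; move: gC; rewrite inE => /negP gC [].
  rewrite negb_forall => /existsP[d]; rewrite negb_imply => /andP[/eqP e dne].
  exists d => //; rewrite in_set e n andbT inE; apply/negP => dF.
  have /singleP := full_colP d.1 dF; rewrite -surjective_pairing => /(_ (r, g) (esym e)) e'.
  by rewrite e' eqxx in dne.
have sub : symbols L \subset sym L @: (setX setT full_cols) :|: symset L T :|: sym L @: D.
  apply/subsetP => _ /imsetP[c _ ->]; rewrite !in_setU.
  case: (boolP (sym L c \in symset L T)) => [_|n]; first by rewrite orbT.
  case: (boolP (c.2 \in full_cols)) => cF.
    by rewrite (_ : sym L c \in _ = true) //; apply/imsetP; exists c; rewrite // inE in_setT.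
  by rewrite (_ : (sym L c \in sym L @: D) = true) ?orbT //; apply/imsetP; exists c; rewrite // in_set n inE cF.
have h1 := subset_leq_card sub.
have h2 := leq_card_setU (sym L @: (setX setT full_cols) :|: symset L T) (sym L @: D).
have h3 := leq_card_setU (sym L @: (setX setT full_cols)) (symset L T).
have h4 := leq_imset_card (sym L) (mem (setX [set: I] full_cols)).
rewrite cardsX cardsT in h4; rewrite (card_symset pT) in h3.
rewrite cKC -cDK.
have arith (s u v w x y k d p : nat) : s <= u -> u <= v + w -> v <= x + y -> x <= p -> w.*2 <= d ->
  s.*2 + k <= p.*2 + y.*2 + (k + d) by clear; lia.
exact: (arith _ _ _ _ _ _ _ _ _ h1 h2 h3 h4 D2).
Qed.
End Lines.

(** * Estimates *)

(** Eliminating [NK] leaves a bound that is weakest at [k = f]: on the interval from [f] to [t] the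
    concave [k(n - k)] is at least its end value [f t], and the remaining term [2k] increases. *)
Lemma cols_arith_nat (n t f k S NK : nat) : n = t + f -> 1 < f -> f <= k -> k <= t ->
  k * (n - k).+1 + t <= NK + (n - k) ->
  S.*2 + NK <= (n * f.-1).*2 + t.*2 + n * t.+1 ->
  S.*2 + f * 2 <= n * n + t + f * f.
Proof.
move=> en f1 fk kt h1 h2.
have [d dE] : exists d, k = f + d by exists (k - f); clear -fk; lia.
have [e eE] : exists e, t = f + d + e by exists (t - k); clear -kt dE; lia.
have [g gE] : exists g, f = g.+1 by exists f.-1; clear -f1; lia.
have nk : n - k = f + e by clear -en dE eE; lia.
rewrite nk in h1; subst n k t f; clear f1 fk kt nk.
rewrite /= in h2; nia.
Qed.

Section RealEstimates.
Local Open Scope ring_scope.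

Lemma natr_pred (R : realFieldType) n : (0 < n)%N -> (n.-1)%:R = n%:R - 1 :> R.
Proof. by case: n => // n _; rewrite -natr1 addrK. Qed.

Section Arithmetic.
Variables (R : realFieldType).
Implicit Types (s N M Q A B F T SS l : R).

Lemma quad_bound s N : s < 14143 / 10000 -> 1714 / 10000 * (N * N) <= (3 - 2 * s) * (N * N).
Proof. by move=> h; apply: ler_wpM2r; [rewrite -expr2 sqr_ge0 | lra]. Qed.

Lemma no_root s N : s < 14143 / 10000 -> 0 < (3 - 2 * s) * (N * N) - N + 2.
Proof.
move=> h; have := quad_bound N h; have := sqr_ge0 (N - 3); rewrite expr2; clear h; nra.
Qed.

(** The lost symbols force [M < (s - 1)N - s/2]. The pair count then has leading coefficient
    [1 + (s - 1)^2 = 2(2 - s)], the linear terms cancel, and the constant left over is negative.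
    This is where [2 - sqrt 2] comes from. *)
Lemma main_real s N M Q l SS : s * s = 2 -> s < 14143 / 10000 -> 1 <= M ->
  M = N - 1 - Q -> l <= 2 * Q -> SS * 2 <= (N + 2) * (N - 1) + M * (M - 1) ->
  (2 - s) * (N * N) <= SS ->
  (2 - s) * (N * N) - (2 - s) * ((N - 1) * (N - 1)) < l -> False.
Proof.
move=> S2 S3 M1 eM hl h1 h2 h3.
have hU : M < (s - 1) * N - s / 2.
  have e : (2 - s) * (N * N) - (2 - s) * ((N - 1) * (N - 1)) = (2 - s) * (2 * N - 1) by ring.
  rewrite e in h3; have h4 := lt_le_trans h3 hl; clear h3 h1 h2 hl e; rewrite eM; clear -h4; nra.
set U := (s - 1) * N - s / 2 in hU.
have hUU : M * (M - 1) <= U * (U - 1).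
  apply: ler_pM; clear -M1 hU; lra.
have e : U * (U - 1) = (3 - 2 * s) * (N * N) - N + (1 + s) / 2.
  have -> : U * (U - 1) = (s * s - 2 * s + 1) * (N * N) - (s * s - 1) * N + s * s / 4 + s / 2.
    by rewrite /U; field.
  by rewrite S2; field.
rewrite e in hUU; clear -hUU h1 h2 S3.
have h4 : SS * 2 <= (N + 2) * (N - 1) + ((3 - 2 * s) * (N * N) - N + (1 + s) / 2).
  by apply: le_trans h1 _; rewrite lerD2l.
have h5 : 2 * ((2 - s) * (N * N)) <= SS * 2 by rewrite [SS * 2]mulrC ler_pM2l // ltr0n.
have := le_trans h5 h4; clear h4 h5 hUU h1 h2.
have -> : (N + 2) * (N - 1) + ((3 - 2 * s) * (N * N) - N + (1 + s) / 2)
  = 2 * ((2 - s) * (N * N)) - (3 - s) / 2 by field.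
lra.
Qed.

(** With [K = (3 - 2s)N] both [A] and [B] exceed [K + s - 1]. After [s * s = 2] the difference of
    the two sides becomes a square plus a positive constant. *)
Lemma growth_real s N A B : s * s = 2 -> 1414 / 1000 < s -> s < 14143 / 10000 -> 1 <= N ->
  (A + 2) * (B + 1) + A <= N ->
  (2 - s) * (N * N) - (2 - s) * ((N - 1) * (N - 1)) < N + A - 1 ->
  (2 - s) * (N * N) - (2 - s) * ((N - 1) * (N - 1)) < N + B - 1 -> False.
Proof.
move=> S2 S1 S3 N1 h1.
have -> : (2 - s) * (N * N) - (2 - s) * ((N - 1) * (N - 1)) = (3 - 2 * s) * N + N + s - 2 by ring.
move=> h2 h3.
have kN : 0 < (3 - 2 * s) * N by apply: mulr_gt0; clear -S3 N1; lra.
move: h2 h3 kN; set K := (3 - 2 * s) * N => h2 h3 kN.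
have hAB : (K + s + 1) * (K + s) <= (A + 2) * (B + 1).
  by apply: ler_pM; clear -kN S1 h2 h3; lra.
have h4 : (K + s + 1) * (K + s) + (K + s - 1) <= N.
  by apply: le_trans h1; apply: lerD hAB _; clear -h2; lra.
have e : (K + s + 1) * (K + s) + (K + s - 1) - N = (K - 1 / 2) ^+ 2 + 3 / 4 + 2 * s.
  have -> : (K + s + 1) * (K + s) + (K + s - 1) - N
    = K ^+ 2 + (2 * s + 5 - 4 * (s * s)) * N + s * s + 2 * s - 1 by rewrite /K; ring.
  by rewrite S2 /K; field.
have h5 : (K + s + 1) * (K + s) + (K + s - 1) - N <= 0 by rewrite subr_le0.
rewrite e in h5; have := sqr_ge0 (K - 1 / 2); clear -h5 S1; lra.
Qed.

Lemma cols_real s N T F : s < 14143 / 10000 -> N = T + F -> F <= T -> 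
  F = 2 \/ F = 3 /\ 3 <= T \/ 4 <= F ->
  (3 - 2 * s) * (N * N) + F * 2 <= T + F * F ->
  F * (F - 1) <= 2 * T \/ F * (F - 1) + (F + 1) * T <= T * T -> False.
Proof.
move=> S3 eN TF cF h6.
have k1 := quad_bound N S3.
have h7 : 1714 / 10000 * (N * N) + F * 2 <= T + F * F.
  by apply: le_trans h6; rewrite lerD2r.
clear k1 h6 S3; rewrite eN in h7; clear eN; case=> ds.
  case: cF => [FE|[[FE T3]|F4]].
  - by rewrite FE in h7; clear -h7; nra.
  - by rewrite FE in h7; clear -h7 T3; nra.
  (* Here [F * F <= F + 2 * T] and [4 <= F] reduce everything to a quadratic in [T + F] without real
     roots. *)
  have h8 : 1714 / 10000 * ((T + F) * (T + F)) <= 3 * (T + F) - 16.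
    apply: le_trans (_ : T - F * 2 + F * F <= _); first by clear -h7; lra.
    have : F * (F - 1) = F * F - F by ring.
    by clear -ds F4; nra.
  have := sqr_ge0 (T + F - 9); rewrite expr2; move: h8; set X := T + F.
  by clear; nra.
have F2 : 2 <= F by case: cF => [->|[[-> _]|]]; clear; lra.
clear cF.
(* The second alternative gives [T * T >= F * F + F * T], so [T / F] is at least the golden ratio;
   the rational bound 1.6 suffices. *)
have T16 : 16 / 10 * F < T.
  rewrite ltNge; apply/negP => le; clear h7; nra.
case: (lerP T (2 * F)) => T2.
  have : (26 / 10 * F) * (26 / 10 * F) <= (T + F) * (T + F) by apply: ler_pM; clear -T16 F2; lra.
  clear -h7 T2 F2 T16; nra.
clear ds T16 TF; nra.
Qed.
End Arithmetic.

Section NatArithmetic.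
Variables (R : realFieldType) (s : R).

Lemma main_arith (n q m S l : nat) : s * s = 2 -> s < 14143 / 10000 ->
  n = (q + m).+1 -> (l <= 2 * q)%N ->
  (S.*2 <= n.+2 * n.-1 + m * m.-1)%N -> (2 - s) * (n ^ 2)%:R <= S%:R ->
  (2 - s) * (n ^ 2)%:R - (2 - s) * (n.-1 ^ 2)%:R < l%:R -> False.
Proof.
move=> S2 S3 en lq h1 h2 h3.
have n0 : (0 < n)%N by rewrite en.
have hl : l%:R <= 2 * q%:R :> R by rewrite -natrM ler_nat.
have em : (m%:R = n%:R - 1 - q%:R :> R).
  by rewrite en -natr1 natrD addrK addrC addKr.
move: h1; rewrite -(ler_nat R) -muln2 natrD !natrM (natr_pred _ n0) -[n.+2]addn2 natrD => h1.
rewrite !natrX !expr2 (natr_pred _ n0) in h2 h3.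
(* For [m = 0] the predecessor is truncated, so it cannot be cast to [m - 1]. *)
case: (posnP m) => [m0|m0].
  rewrite m0 mul0r addr0 in h1; have := no_root n%:R S3; clear -h1 h2; nra.
rewrite (natr_pred _ m0) in h1; have m1 : 1 <= m%:R :> R by rewrite ler1n.
exact: (main_real S2 S3 m1 em hl h1 h2 h3).
Qed.

Lemma growth_arith (n a b : nat) : s * s = 2 -> 1414 / 1000 < s -> s < 14143 / 10000 ->
  (0 < n)%N -> ((a + 2) * (b + 1) + a <= n)%N ->
  (2 - s) * (n ^ 2)%:R - (2 - s) * (n.-1 ^ 2)%:R < (n + a).-1%:R ->
  (2 - s) * (n ^ 2)%:R - (2 - s) * (n.-1 ^ 2)%:R < (n + b).-1%:R -> False.
Proof.
move=> S2 S1 S3 n0 h1 h2 h3.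
have n1 : 1 <= n%:R :> R by rewrite ler1n.
have na x : (0 < n + x)%N by rewrite addn_gt0 n0.
rewrite !natrX !expr2 !natr_pred // !natrD in h2 h3.
move: h1; rewrite -(ler_nat R) natrD natrM !natrD => h1.
exact: (growth_real S2 S1 S3 n1 h1 h2 h3).
Qed.

Lemma cols_arith (n t f k S NK : nat) : s < 14143 / 10000 ->
  n = (t + f)%N -> (1 < f)%N -> (f <= k)%N -> (k <= t)%N ->
  (k * (n - k).+1 + t <= NK + (n - k))%N ->
  (S.*2 + NK <= (n * f.-1).*2 + t.*2 + n * t.+1)%N ->
  (f * f.-1 <= 2 * t)%N \/ (f * f.-1 + f.+1 * t <= t * t)%N ->
  (2 - s) * (n ^ 2)%:R <= S%:R -> False.
Proof.
move=> S3 en f1 fk kt h1 h2 ds hS.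
have h3 := cols_arith_nat en f1 fk kt h1 h2.
have tf := leq_trans fk kt.
have cF : f%:R = 2 :> R \/ (f%:R = 3 :> R /\ 3 <= t%:R :> R) \/ 4 <= f%:R :> R.
  have : f = 2 \/ f = 3 \/ (4 <= f)%N by clear -f1; lia.
  case=> [->|[e|h]]; first by left.
    by right; left; rewrite e; split=> //; rewrite (ler_nat R 3); move: tf; rewrite e.
  by right; right; rewrite (ler_nat R 4).
have eN : n%:R = t%:R + f%:R :> R by rewrite en natrD.
have TF : f%:R <= t%:R :> R by rewrite ler_nat.
have f0 : (0 < f)%N by exact: ltnW.
have h6 : (3 - 2 * s) * (n%:R * n%:R) + f%:R * 2 <= t%:R + f%:R * f%:R.
  move: h3; rewrite -(ler_nat R) -muln2 !(natrD, natrM) => h3.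
  by rewrite natrX expr2 in hS; clear -h3 hS; nra.
apply: (cols_real S3 eN TF cF h6).
case: ds => ds; [left|right]; move: ds; rewrite -(ler_nat R).
  by rewrite !natrM (natr_pred _ f0).
by rewrite natrD !natrM (natr_pred _ f0) -natr1.
Qed.

Lemma half_arith (n S : nat) : s < 14143 / 10000 ->
  (0 < n)%N -> (S.*2 <= n * n)%N -> (2 - s) * (n ^ 2)%:R <= S%:R -> False.
Proof.
move=> S3 n0; rewrite -(ler_nat R) -muln2 natrX expr2 !natrM => h1 h2.
have hn : 1 <= n%:R :> R by rewrite ler1n.
have : 1 * 1 <= n%:R * n%:R :> R by apply: ler_pM; rewrite ?ler01.
have := quad_bound n%:R S3; clear -h1 h2; nra.
Qed.
End NatArithmetic.

Lemma sqrt2_bounds (R : rcfType) (s : R) : s = Num.sqrt 2 ->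
  [/\ s * s = 2, 1414 / 1000 < s & s < 14143 / 10000].
Proof.
move=> es; have s2 : s * s = 2 by rewrite es -expr2 sqr_sqrtr // ler0n.
have s0 : 0 <= s by rewrite es sqrtr_ge0.
by clear es; split=> //; nra.
Qed.
End RealEstimates.

(** * The minimal counterexample *)

Definition transpose (I J Y : Type) (L : I -> J -> Y) j i := L i j.
Definition flip (I J : Type) (c : I * J) := (c.2, c.1).

Lemma flip_inj (I J : Type) : injective (@flip I J).
Proof. by move=> [a b] [c d] [-> ->]. Qed.

Section Transpose.
Variables (I J Y : finType) (L : I -> J -> Y).
Local Notation Lt := (transpose L).

Lemma latin_tr : latin L -> latin Lt.
Proof. by move=> [h1 h2]; split=> [j|i]; [exact: h2|exact: h1]. Qed.

Lemma pt_tr (T : {set I * J}) : pt L T -> pt Lt (@flip I J @: T).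
Proof.
move/ptP => h; apply/ptP => _ _ /imsetP[c cT ->] /imsetP[d dT ->] cl.
congr flip; apply: h => //; move: cl; rewrite /clash /flip /sym /transpose /=.
by case/or3P => ->; rewrite ?orbT.
Qed.

Lemma card_flip (T : {set I * J}) : #|@flip I J @: T| = #|T|.
Proof. by rewrite card_imset //; exact: flip_inj. Qed.

Lemma single_tr i j : single Lt (j, i) = single L (i, j).
Proof.
apply/singleP/singleP => h [a b] e; have [] := h (b, a) e; by move=> -> ->.
Qed.

Lemma symbols_tr : symbols Lt = symbols L.
Proof.
by apply/setP => y; apply/imsetP/imsetP => -[[a b] _ ->]; exists (b, a).
Qed.

Lemma lost_tr i j : lost Lt j i = lost L i j.
Proof.
apply/setP => y; apply/lostP/lostP; rewrite symbols_tr => -[h1 h2]; split=> // -[a b] e.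
  by have /= [->|->] := h2 (b, a) e; [right|left].
by have /= [->|->] := h2 (b, a) e; [right|left].
Qed.

Lemma full_rows_tr : full_rows Lt = full_cols L.
Proof.
by apply/setP => j; rewrite !in_set; apply: eq_forallb => i; rewrite single_tr.
Qed.
Lemma full_cols_tr : full_cols Lt = full_rows L.
Proof.
by apply/setP => j; rewrite !in_set; apply: eq_forallb => i; rewrite single_tr.
Qed.
End Transpose.

Section Critical.
Variables (R : rcfType).
Local Notation s := (Num.sqrt (2 : R)).
Local Notation c := (2 - s)%R.

Definition weight (n : nat) : R := (c * (n ^ 2)%:R)%R.

(** What minimality provides: [crit_clone] comes from recolouring a repeated cell, [crit_lost] from
    deleting the lines of a single one. Rows and columns have separate index types, so the record is
    stable under transposition and results on rows transfer to columns. *)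
Record critical (I J Y : finType) (L : I -> J -> Y) : Prop := Critical {
  crit_card : #|I| = #|J|;
  crit_latin : latin L;
  crit_none : forall T, pt L T -> #|T| < #|I|;
  crit_clone : forall i j, ~~ single L (i, j) ->
    exists T, [/\ pt L T, #|T| = #|I|.-1, i \notin rows T & j \notin cols T];
  crit_lost : forall i j, single L (i, j) ->
    (weight #|I| - weight #|I|.-1 < #|lost L i j|%:R)%R;
  crit_symbols : (weight #|I| <= #|symbols L|%:R)%R }.

Lemma critical_tr (I J Y : finType) (L : I -> J -> Y) : critical L -> critical (transpose L).
Proof.
case=> h1 h2 h3 h4 h5 h6; split.
- by [].
- exact: latin_tr.
- by move=> T /pt_tr /h3; rewrite card_flip h1.
- move=> j i; rewrite single_tr => /h4[T [pT cT iT jT]].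
  exists (@flip I J @: T); split; first exact: pt_tr.
  + by rewrite card_flip cT h1.
  + by apply: contra jT => /imsetP[_ /imsetP[d dT ->] ->]; exact: mem_cols.
  + by apply: contra iT => /imsetP[_ /imsetP[d dT ->] ->]; exact: mem_rows.
- by move=> j i; rewrite single_tr lost_tr -h1; exact: h5.
- by rewrite symbols_tr -h1.
Qed.

Section Fixed.
Variables (I J Y : finType) (L : I -> J -> Y).
Hypothesis critL : critical L.

Lemma crit_gt0 : 0 < #|I|.
Proof.
have := crit_none critL (T := set0); rewrite cards0; apply.
by apply/ptP => x y; rewrite inE.
Qed.

Lemma lost_split i j : lost L i j =
  (lost L i j :&: [set L i g | g : J]) :|: (lost L i j :&: [set L r j | r : I]).
Proof.
rewrite -setIUr; apply/esym/setIidPl/subsetP => y /lostP[/imsetP[d _ ->] h].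
rewrite in_setU; case: (h d erefl) => e; apply/orP; [left|right]; apply/imsetP.
  by exists d.2; rewrite // -e.
by exists d.1; rewrite // -e.
Qed.

Lemma large_row i j : single L (i, j) -> i \notin full_rows L ->
  #|lost L i j :&: [set L r j | r : I]| <= #|lost L i j :&: [set L i g | g : J]| -> False.
Proof.
move=> sij; rewrite in_set negb_forall => /existsP[j' nj'] le.
have [S2 S1 S3] := @sqrt2_bounds R s erefl.
have [T [pT cT iT jT]] := crit_clone critL nj'.
have jj : j' != j by apply: contraNneq nj' => ->.
have [q [m [e h1 h2 h3]]] :=
  row_bound (crit_latin critL) (crit_card critL) (crit_none critL) sij pT cT iT jT jj.
apply: (main_arith S2 S3 e _ h3 (crit_symbols critL) (crit_lost critL sij)).
rewrite lost_split.
(* The lost symbols number [#|A :\: B| + #|B|], at most [(q - 1) + (q + 1)], since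
   [#|B| <= #|A|]. *)
have arith (a b u x d q' : nat) : b <= a -> a <= q'.+1 -> d < q' -> x + d = a ->
  u + x = a + b -> u <= 2 * q' by clear; lia.
exact: (arith _ _ _ _ _ _ le h1 h2 (cardsID _ _) (cardsUI _ _)).
Qed.
End Fixed.

Lemma single_full (I J Y : finType) (L : I -> J -> Y) : critical L ->
  forall i j, single L (i, j) -> i \in full_rows L \/ j \in full_cols L.
Proof.
move=> cr i j sij; case: (boolP (i \in full_rows L)) => [|ni]; first by left.
case: (boolP (j \in full_cols L)) => [|nj]; first by right.
exfalso; case: (leqP #|lost L i j :&: [set L r j | r : I]| #|lost L i j :&: [set L i g | g : J]|).
  exact: (large_row cr sij ni).
move/ltnW; rewrite -lost_tr; apply: (large_row (critical_tr cr)).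
  by rewrite single_tr.
by rewrite full_rows_tr.
Qed.

Lemma full_row_weight (I J Y : finType) (L : I -> J -> Y) : critical L ->
  full_rows L != set0 -> (weight #|I| - weight #|I|.-1 < (#|I| + #|full_rows L|).-1%:R)%R.
Proof.
move=> cr /set0Pn[i iF].
(* If all columns were full, the empty partial transversal could be completed. *)
have [j jF] : exists j, j \notin full_cols L.
  apply/existsP; rewrite -negb_forall; apply/negP => /forallP all.
  have e : full_cols L = setT by apply/setP => j; rewrite all in_setT.
  have := @complete_pt _ _ _ L set0 (crit_card cr) (sub0set _).
  rewrite cards0 e cardsT -(crit_card cr) add0n leq_addl => -[||T [/(crit_none cr)]] //.
    by apply/ptP => x y; rewrite inE.
  by move=> + e'; rewrite e' ltnn.
apply: lt_le_trans (crit_lost cr (full_rowP j iF)) _; rewrite ler_nat.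
have := lost_full (crit_latin cr) iF jF (single_full cr).
by rewrite -(crit_card cr); case: (#|I| + _).
Qed.

Lemma no_full_both (I J Y : finType) (L : I -> J -> Y) : critical L ->
  full_rows L != set0 -> full_cols L != set0 -> False.
Proof.
move=> cr r0 c0; have [S2 S1 S3] := @sqrt2_bounds R s erefl.
have h1 := full_row_weight cr r0.
have h2 : (weight #|I| - weight #|I|.-1 < (#|I| + #|full_cols L|).-1%:R)%R.
  have := full_row_weight (critical_tr cr); rewrite full_rows_tr -(crit_card cr); exact.
apply: (growth_arith S2 S1 S3 (crit_gt0 cr) _ h1 h2).
pose X := setX (~: full_rows L) (~: full_cols L).
pose st (T : {set I * J}) := (T \subset X) && pt L T.
have st0 : st set0 by rewrite /st sub0set; apply/ptP => x y; rewrite inE.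
have [T []] : exists T, st T /\ forall T', st T' -> #|T'| <= #|T|.
  by exists [arg max_(T > set0 | st T) #|T|]; case: arg_maxnP.
move=> /andP[sT pT] maxT.
have lt : #|T| + #|full_rows L| + #|full_cols L| < #|I|.
  rewrite ltnNge; apply/negP => big.
  have [T' [/(crit_none cr)]] := complete_pt (crit_card cr) sT pT big.
  by move=> + e; rewrite e ltnn.
have := growth (crit_latin cr) sT pT _.
have mx (T' : {set I * J}) : T' \subset X -> pt L T' -> #|T'| <= #|T| by move=> s1 p1; apply: maxT; rewrite /st s1.
move=> /(_ mx); rewrite !cardsD.
have rT : rows T \subset ~: full_rows L.
  by apply/subsetP => _ /imsetP[d /(subsetP sT) + ->]; rewrite inE => /andP[].
have cT : cols T \subset ~: full_cols L.
  by apply/subsetP => _ /imsetP[d /(subsetP sT) + ->]; rewrite inE => /andP[].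
rewrite (setIidPr rT) (setIidPr cT) (card_rows pT) (card_cols pT).
have -> : #|~: full_rows L| = #|I| - #|full_rows L| by rewrite cardsCs setCK.
have -> : #|~: full_cols L| = #|I| - #|full_cols L| by rewrite cardsCs setCK (crit_card cr).
move: lt; clear; move: #|I| #|T| #|full_rows L| #|full_cols L| => n t a b lt h.
have [d e] : exists d, n = t + a + b + d.+1 by exists (n - (t + a + b)).-1; lia.
have e1 : n - b - t = a + d.+1 by lia.
have e2 : n - a - t = b + d.+1 by lia.
rewrite e1 e2 in h; nia.
Qed.

Lemma no_full_cols (I J Y : finType) (L : I -> J -> Y) : critical L ->
  full_rows L = set0 -> full_cols L != set0 -> False.
Proof.
move=> cr r0 c0; have [S2 S1 S3] := @sqrt2_bounds R s erefl.
set b := #|full_cols L|; set B := ~: full_cols L.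
have b0 : 0 < b by rewrite card_gt0.
have bnd (T : {set I * J}) : T \subset setX [set: I] B -> pt L T -> #|T| + b < #|I|.
  move=> sT pT; rewrite ltnNge; apply/negP => big.
  have [||T' [/(crit_none cr)]] := complete_pt (crit_card cr) _ pT.
  - by rewrite r0 setC0.
  - by rewrite r0 cards0 addn0.
  by move=> + e; rewrite e ltnn.
have bn : b < #|I|.
  have := bnd set0 (sub0set _); rewrite cards0 add0n; apply.
  by apply/ptP => x y; rewrite inE.
(* One less than the number of non-full columns. More cells could be completed to a transversal; [t]
   is attained, because the [#|I| - 1] cells provided by [crit_clone] include at most [b] in full
   columns. *)
set t := (#|I| - b).-1.
have cB : #|B| = t.+1 by rewrite cardsCs setCK -(crit_card cr) /t -/b; clear -bn; lia.
have maxB (T : {set I * J}) : T \subset setX [set: I] B -> pt L T -> #|T| <= t.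
  by move=> /bnd h /h; rewrite /t; clear; lia.
have [i _] : exists i : I, i \in setT.
  by apply/set0Pn; rewrite -card_gt0 cardsT; exact: crit_gt0 cr.
have [j jB] : exists j, j \in B by apply/set0Pn; rewrite -card_gt0 cB.
have clone : ~~ single L (i, j).
  apply/negP => /(single_full cr); rewrite r0 in_set0; case=> // h.
  by move: jB; rewrite in_setC h.
have [T [pT cT _ _]] := crit_clone cr clone.
have exB : exists2 T : {set I * J}, T \subset setX [set: I] B & pt L T /\ #|T| = t.
  pose T' := T :&: setX [set: I] B; exists T'; first exact: subsetIr.
  have pT' : pt L T' by apply: pt_sub pT; exact: subsetIl.
  split=> //; apply/eqP; rewrite eqn_leq maxB ?subsetIr //=.
  have : #|T :\: setX [set: I] B| <= b.
    rewrite -(card_cols (pt_sub (subsetDl _ _) pT)); apply: subset_leq_card.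
    by apply/subsetP => _ /imsetP[d /setDP[_ +] ->]; rewrite inE in_setT /= in_setC negbK.
  have arith (x y m b' : nat) : x + y = m.-1 -> y <= b' -> (m - b').-1 <= x by clear; lia.
  by apply: arith; rewrite -cT; exact: cardsID.
have [T1 [k [sT1 pT1 cT1 [kt nk kn kk]]]] := kappa_count (crit_latin cr) cB maxB exB.
have cnt := full_cols_count r0 (single_full cr) pT1.
have [g gB gT1] : exists2 g, g \in B & g \notin cols T1.
  apply/subsetPn; apply/negP => /subset_leq_card; rewrite cB (card_cols pT1) cT1; clear; lia.
have mx (T' : {set I * J}) : T' \subset setX [set: I] B -> pt L T' -> #|T'| <= #|T1|.
  by rewrite cT1; exact: maxB.
have := double_swap (crit_latin cr) sT1 pT1 mx gB gT1.
rewrite setTD cardsCs setCK (card_rows pT1) cT1.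
have ef : #|I| - t = b.+1 by rewrite /t; clear -bn; lia.
rewrite ef => ds.
move: cnt; rewrite cT1 -/B cB -/b => cnt.
have en : #|I| = t + b.+1 by clear -ef bn; lia.
have fk : b.+1 <= k by clear -nk en; lia.
exact: (cols_arith S3 en _ fk kt kk cnt ds (crit_symbols cr)).
Qed.

Lemma not_critical (I J Y : finType) (L : I -> J -> Y) : critical L -> False.
Proof.
move=> cr; have [S2 S1 S3] := @sqrt2_bounds R s erefl.
case: (boolP [exists d, single L d]) => [/existsP[[i j] sij]|/existsPn none].
  case: (eqVneq (full_rows L) set0) => [r0|r0].
    case: (eqVneq (full_cols L) set0) => [c0|]; last exact: no_full_cols.
    by have := single_full cr sij; rewrite r0 c0 !in_set0; case.
  case: (eqVneq (full_cols L) set0) => [c0|c0]; last exact: (no_full_both cr).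
  by apply: (no_full_cols (critical_tr cr)); [rewrite full_rows_tr | rewrite full_cols_tr].
(* Without single cells each symbol occurs twice, so at most half of [n ^ 2] symbols exist, while
   [2 - sqrt 2] exceeds one half. *)
apply: (half_arith S3 (crit_gt0 cr) _ (crit_symbols cr)).
have -> : symbols L = sym L @: setT.
  by apply/setP => y; apply/imsetP/imsetP => -[d _ ->]; exists d.
rewrite {2}(crit_card cr) -cardsT -(cardsT J) -cardsX.
have -> : setX [set: I] [set: J] = setT by apply/setP => d; rewrite !inE.
apply: card_symbols_ge2 => d _; have := none d.
by rewrite negb_forall => /existsP[e]; rewrite negb_imply => /andP[/eqP h1 h2]; exists e.
Qed.
End Critical.

(** * Recolouring a cell, and deleting a row and a column *)

Section Recolour.
Variables (I J Y : finType) (L : I -> J -> Y) (i : I) (j : J).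

(** Passing to [option Y] makes [None] a symbol that is certainly new. *)
Definition recolour a b := if (a, b) == (i, j) then None else Some (L a b).

Lemma recolour_sym d e : sym recolour d = sym recolour e -> d = e \/ sym L d = sym L e.
Proof.
rewrite /sym /recolour -!surjective_pairing.
case: eqP => [->|_]; case: eqP => [->|_] //; first by left.
by case; right.
Qed.

Lemma recolour_latin : latin L -> latin recolour.
Proof.
move=> [lr lc]; split=> [a b b' e|b a a' e].
  by case: (@recolour_sym (a, b) (a, b') e) => [[]|/lr].
by case: (@recolour_sym (a, b) (a', b) e) => [[]|/lc].
Qed.

Lemma recolour_pt T : pt recolour T -> (i, j) \notin T -> pt L T.
Proof.
move=> /ptP h n; apply/ptP => d e dT eT cl; apply: h => //; move: cl.
have ne x : x \in T -> sym recolour x = Some (sym L x).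
  move=> xT; rewrite /sym /recolour -surjective_pairing.
  by case: eqP => // xe; rewrite -xe xT in n.
by rewrite /clash !ne.
Qed.

Lemma recolour_symbols : ~~ single L (i, j) -> #|symbols recolour| = #|symbols L|.+1.
Proof.
rewrite negb_forall => /existsP[d]; rewrite negb_imply => /andP[/eqP e dn].
have -> : symbols recolour = None |: Some @: symbols L.
  apply/setP => -[y|]; rewrite in_setU1 /=.
    rewrite (mem_imset _ _ Some_inj); apply/imsetP/imsetP => -[x _].
      by rewrite /sym /recolour -surjective_pairing; case: eqP => // _ [->]; exists x.
    move=> ->; case: (eqVneq x (i, j)) => [->|n].
      by exists d; rewrite // -e /sym /recolour -surjective_pairing (negbTE dn).
    by exists x; rewrite // /sym /recolour -surjective_pairing (negbTE n).
  by apply/imsetP; exists (i, j); rewrite // /sym /recolour eqxx.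
rewrite cardsU1 card_imset; last exact: Some_inj.
by case: imsetP => // -[].
Qed.
End Recolour.

Section Delete.
Variables (I J Y : finType) (L : I -> J -> Y) (i : I) (j : J).
Local Notation I' := {x : I | x != i}.
Local Notation J' := {x : J | x != j}.

Definition delete (a : I') (b : J') := L (val a) (val b).

Lemma delete_latin : latin L -> latin delete.
Proof. by move=> [lr lc]; split=> [a b b' /lr /val_inj|b a a' /lc /val_inj]. Qed.

Lemma delete_symbols : #|symbols L| <= #|symbols delete| + #|lost L i j|.
Proof.
apply: leq_trans (leq_card_setU _ _); apply: subset_leq_card; apply/subsetP => y yS.
rewrite in_setU; case: (boolP (y \in lost L i j)) => [|n]; first by rewrite orbT.
rewrite orbF; move: n; rewrite inE yS negb_forall => /existsP[[a b]].
rewrite negb_imply negb_or => /andP[/eqP <- /andP[/= ai bj]].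
by apply/imsetP; exists (exist _ a ai, exist _ b bj).
Qed.

Lemma delete_pt (T : {set I' * J'}) : single L (i, j) -> pt delete T ->
  exists T', pt L T' /\ #|T'| = #|T|.+1.
Proof.
move=> sij /ptP h; pose g (d : I' * J') := (val d.1, val d.2).
have gI : injective g by move=> [a b] [a' b'] [/val_inj -> /val_inj ->].
have p : pt L (g @: T).
  apply/ptP => _ _ /imsetP[d dT ->] /imsetP[e eT ->] cl; congr g; exact: h.
have [||p2 c2] := pt_add_single p sij.
- by apply/imsetP => -[_ /imsetP[[[a ai] b] _ ->] /= e]; rewrite e eqxx in ai.
- by apply/imsetP => -[_ /imsetP[[a [b bj]] _ ->] /= e]; rewrite e eqxx in bj.
by exists ((i, j) |: g @: T); rewrite c2 card_imset.
Qed.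
End Delete.

(** Induction on the order, then on the number of symbols missing from [n ^ 2]. The index and symbol
    types are generalised, because deletion changes the former and recolouring the latter. *)
Theorem many_symbols (R : rcfType) n k (I J Y : finType) (L : I -> J -> Y) :
  #|I| = n -> #|J| = n -> latin L -> n ^ 2 - #|symbols L| = k ->
  (weight R n <= #|symbols L|%:R)%R -> exists T, pt L T /\ #|T| = n.
Proof.
elim/ltn_ind: n k I J Y L => n IHn k; elim/ltn_ind: k => k IHk I J Y L cI cJ latL ek big.
case: (boolP [exists T, pt L T && (#|T| == n)]) => [/existsP[T /andP[p /eqP e]]|none].
  by exists T.
have notr T : pt L T -> #|T| < #|I|.
  move=> p; rewrite ltn_neqAle -{2}(card_rows p) max_card andbT cI.
  by apply: contraNneq none => e; apply/existsP; exists T; rewrite p e eqxx.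
exfalso; apply: (@not_critical R _ _ _ L); split=> //; rewrite ?cI ?cJ //.
- move=> i j nij; have cS := recolour_symbols nij.
  have le : #|symbols (recolour L i j)| <= n ^ 2.
    apply: leq_trans (leq_imset_card _ _) _.
    by rewrite -[in X in _ <= X]cI expnS expn1 {2}cI -cJ card_prod.
  have lt : n ^ 2 - #|symbols (recolour L i j)| < k by clear -cS le ek; lia.
  have big' : (weight R n <= #|symbols (recolour L i j)|%:R)%R.
    by apply: le_trans big _; rewrite ler_nat cS.
  have [T [p cT]] := IHk _ lt _ _ _ _ cI cJ (@recolour_latin _ _ _ L i j latL) erefl big'.
  (* A transversal of the recoloured array that avoided [(i, j)] would be one of [L]. *)
  have ijT : (i, j) \in T.
    apply/negPn/negP => nT; have := notr T (recolour_pt p nT).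
    by rewrite cT cI ltnn.
  exists (T :\ (i, j)); split.
  + apply: (@recolour_pt _ _ _ _ i j); last by rewrite !inE eqxx.
    by apply: pt_sub p; exact: subsetDl.
  + by rewrite -cT (cardsD1 (i, j) T) ijT.
  + apply/imsetP => -[d /setD1P[dn dT] e].
    by move: dn; rewrite (pt_row p dT ijT (esym e)) eqxx.
  + apply/imsetP => -[d /setD1P[dn dT] e].
    by move: dn; rewrite (pt_col p dT ijT (esym e)) eqxx.
- move=> i j sij; have n0 : 0 < n by rewrite -cI; apply/card_gt0P; exists i.
  rewrite ltrBlDr; apply: le_lt_trans big _.
  have le : (#|symbols L|%:R <= (#|symbols (@delete _ _ _ L i j)| + #|lost L i j|)%N%:R :> R)%R.
    by rewrite ler_nat delete_symbols.
  apply: le_lt_trans le _.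
  (* If too few symbols were lost, the smaller array would have a transversal, and the single cell
     [(i, j)] would extend it. *)
  rewrite natrD addrC ltrD2l ltNge; apply/negP => big'.
  have cI' : #|{: {x : I | x != i}}| = n.-1 by rewrite card_sig -cI cardC1.
  have cJ' : #|{: {x : J | x != j}}| = n.-1 by rewrite card_sig -cJ cardC1.
  have lt : n.-1 < n by rewrite prednK.
  have [T [p cT]] := IHn _ lt _ _ _ _ _ cI' cJ' (@delete_latin _ _ _ L i j latL) erefl big'.
  have [T' [p' cT']] := delete_pt sij p.
  by have := notr T' p'; rewrite cT' cT prednK // cI ltnn.
Qed.

(** * From arbitrary symbols to a finite symbol type *)

Local Open Scope ring_scope.

Theorem mainTheorem12 (R : rcfType) (T : eqType) (n : nat)
    (L : 'I_n -> 'I_n -> T) :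
  is_latin L ->
  (2 - Num.sqrt (2 : R)) * (n ^ 2)%:R <= (num_symbols L)%:R ->
  has_transversal L.
Proof.
move=> [lr lc] big.
pose u := [seq L d.1 d.2 | d <- enum [set: 'I_n * 'I_n]].
have Lu a b : L a b \in undup u.
  by rewrite mem_undup; apply/mapP; exists (a, b); rewrite ?mem_enum ?in_setT.
have ltLu a b : (index (L a b) (undup u) < size (undup u))%N by rewrite index_mem.
(* Each symbol is replaced by its index in the list of distinct symbols, so the symbol type becomes
   finite and every index is used. *)
pose L' a b : 'I_(size (undup u)) := Ordinal (ltLu a b).
have L'E a b a' b' : L' a b = L' a' b' -> L a b = L a' b'.
  by move=> [e]; rewrite -(nth_index (L a b) (Lu a b)) e nth_index.
have latL' : latin L' by split=> [a b b' /L'E /lr|b a a' /L'E /lc].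
have cS : #|symbols L'| = num_symbols L.
  have -> : symbols L' = setT.
    apply/setP => y; rewrite in_setT; apply/imsetP.
    have /mapP[[a b] _ e] : tnth (in_tuple (undup u)) y \in u.
      by rewrite -mem_undup mem_tnth.
    exists (a, b) => //; apply: val_inj; rewrite /= /sym /= -e.
    by rewrite (tnth_nth (L a b)) /= index_uniq // undup_uniq.
  by rewrite cardsT card_ord.
have [S [/ptP p cS']] : exists S, pt L' S /\ #|S| = n.
  by apply: (many_symbols (R := R) _ _ latL' erefl); rewrite ?card_ord // cS.
exists S; split=> // d e dS eS ne.
have h : clash L' d e -> False by move=> cl; exact/ne/p.
split=> k; apply: h; rewrite /clash; first by rewrite k eqxx.
  by rewrite k eqxx orbT.
apply/or3P; apply: Or33; apply/eqP/val_inj; rewrite /= /sym /=.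
by rewrite k.
Qed.
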